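(* Let $p$ be a prime with $p\equiv 1,3\pmod 8$, and write $p=x^2+2y^2$ with integers $x,y$. Then $$\sum_{k=0}^{(p-1)/2}\frac{\binom{2k}k^3}{(-64)^k(k+1)}\equiv(-1)^{\frac{p-1}2}(-12y^2+2p)\pmod{p^2}.$$
   Context: For a prime $p$, congruences modulo $p^r$ between rational numbers whose denominators are prime to $p$ mean that the difference is $p^r$ times a rational number with denominator prime to $p$. *)

(* Defs.v *)
From mathcomp Require Import all_boot all_order all_algebra.
Set Implicit Arguments. Unset Strict Implicit. Unset Printing Implicit Defensive.
Import Order.TTheory GRing.Theory Num.Theory.
Local Open Scope ring_scope.

Definition rat_congr_pow (p r : nat) (a b : rat) : Prop :=
  exists (c d : int), ~~ (p%:Z %| d)%Z /\ a - b = (p ^ r)%:R * (c%:~R / d%:~R).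

(* Main.v *)
(** Write [n = (p - 1) / 2] and [eps = (-1) ^ n].  Modulo [p ^ 2] the binomial factor
    ['C(2k, k) ^ 3 / (-64) ^ k] may be replaced by the hypergeometric term
    [(1/2)_k (-n)_k (n+1)_k (-1)^k / (k! (n+3/2)_k (1/2-n)_k)], whose sum [T] over [k] has
    a closed form (a transformation and a summation theorem of Whipple), obtained here by
    creative telescoping.  The contiguous relations between the moments of this term
    show that the sum with weights [1 / (k + 1)] is [3/2 T - eps p] modulo [p ^ 2].

    On the other hand let [J] be the Jacobi sum over the field with [q = p ^ 2] elements of
    the quadratic character and of a character [chi] of order 8.  The relation
    [J(phi, chi) J(chi^5, chi^7) = q chi(-1)] and its analogue for [chi^3] give
    [J(phi, chi) = J(phi, chi^3)], so [J = a + b sqrt(-2)] with integers such that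
    [a^2 + 2 b^2 = p^2]; also [a = -1] modulo 4, and therefore
    [2 a = - eps (4 x^2 - 2 p)].  Replacing the characters by Teichmueller lifts in the
    Galois ring of order [p ^ 4] gives [2 a] modulo [p ^ 2] as a coefficient of a
    polynomial, which is congruent to [- T] by a computation with harmonic numbers. *)
From HB Require Import structures.
Require Import Defs.
From mathcomp Require Import all_boot all_order all_algebra.
From mathcomp Require Import all_fingroup all_solvable all_field.
From mathcomp Require Import ring lra zify.
Set Implicit Arguments. Unset Strict Implicit. Unset Printing Implicit Defensive.
Import Order.TTheory GRing.Theory Num.Theory.
Local Open Scope ring_scope.

(** * Creative telescoping *)

(** The field with [p ^ 2] elements serves both residue classes: for [p = 3] modulo 8 there is no
    character of order 8 on the field with [p] elements, while 8 divides [p ^ 2 - 1] for every odd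
    [p]. The base [p] digits of [(p ^ 2 - 1) / 8] are [f, f] when [p = 8 f + 1] and [3 f + 1, f]
    when [p = 8 f + 3]; they produce the binomials ['C(n, f)] that also appear in the closed form of
    [T]. The difficulty is the second power of [p]. Both evaluations have the shape [c (1 + p u)]
    with the same [c], a signed square of ['C(n, f)], so what remains is an identity modulo [p]
    between two combinations [u] of harmonic numbers. On the Jacobi side these arise from expanding
    [(1 - t) ^ p] to first order in [p], which requires a ring where [p ^ 2 = 0] but [p] does not
    vanish. In that ring [J] times its conjugate is [p ^ 2 = 0]; as [J] is a unit, the conjugate
    vanishes and [J] is its own trace [2 a]. The sign of [a] cannot be read off from its norm,
    whence the congruence modulo 4. The value [x ^ 2 - 2 y ^ 2] comes from squaring
    [x + y sqrt(-2)]. *)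

Ltac nz := repeat (apply/andP; split);
  first [assumption | by [] | by apply/eqP=> ?; lra].

(* Ratio of consecutive terms of [hterm]; only [P = 2 n + 1] is used, and [P = p] is a
   perturbation of order [P ^ 2] of the ratio for ['C(2k, k) ^ 3 / (-64) ^ k]. *)
Definition trat (P : rat) (j : nat) : rat :=
  (2 * j%:R + 1) * (P ^+ 2 - (2 * j%:R + 1) ^+ 2) /
  (2 * (j%:R + 1) * (4 * (j%:R + 1) ^+ 2 - P ^+ 2)).

Definition hterm (n k : nat) : rat := \prod_(j < k) trat (2 * n%:R + 1) j.

(** Some denominators change sign with [k] and are nonzero only by parity; the others are positive,
    which [nz] leaves to [lra]. *)
Lemma odd_sub_even_neq0 (n k : nat) : 2 * n%:R + 1 - 2 * k%:R != 0 :> rat.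
Proof.
have -> : 2 * n%:R + 1 - 2 * k%:R = ((n.*2.+1)%:Z - (k.*2)%:Z)%:~R :> rat.
  rewrite rmorphB /= -!pmulrn -addn1 -!mul2n natrD !natrM; ring.
rewrite intr_eq0; lia.
Qed.

Lemma hterm0 n : hterm n 0 = 1. Proof. by rewrite /hterm big_ord0. Qed.

Lemma htermS n k : hterm n k.+1 *
  (2 * (k%:R + 1) * (2 * n%:R + 2 * k%:R + 3) * (2 * k%:R + 1 - 2 * n%:R))
  = hterm n k * ((2 * k%:R + 1) * (2 * n%:R - 2 * k%:R) * (2 * n%:R + 2 * k%:R + 2)).
Proof.
have h1 := odd_sub_even_neq0 k n.
have h2 : k%:R + 1 != 0 :> rat by rewrite natr1 pnatr_eq0.
have h3 : 2 * n%:R + 2 * k%:R + 3 != 0 :> rat.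
  by rewrite -!natrM -!natrD pnatr_eq0 addn_eq0 andbF.
rewrite /hterm big_ord_recr /= /trat.
have h4 : 4 * (k%:R + 1) ^+ 2 - (2 * n%:R + 1) ^+ 2 != 0 :> rat.
  have -> : 4 * (k%:R + 1) ^+ 2 - (2 * n%:R + 1) ^+ 2 =
    (2 * n%:R + 2 * k%:R + 3) * (2 * k%:R + 1 - 2 * n%:R) :> rat by ring.
  by rewrite mulf_neq0.
by field; rewrite h2 h4.
Qed.

(** The factor [j = n] of the product contains [P ^ 2 - (2 n + 1) ^ 2 = 0]. Sums can thus be
    extended freely, and the upper boundary of every telescoping sum vanishes. *)
Lemma hterm_gt n k : (n < k)%N -> hterm n k = 0.
Proof.
move=> lt; rewrite /hterm (bigD1 (Ordinal lt)) //= {1}/trat subrr.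
by rewrite mulr0 !mul0r.
Qed.

Lemma htermSn n k :
  hterm n k * ((2 * n%:R + 1) * (2 * n%:R + 2 * k%:R + 2) * (2 * n%:R + 1 - 2 * k%:R)
     * (2 * n%:R + 3))
  = hterm n.+1 k * ((2 * n%:R + 2 - 2 * k%:R) * (2 * n%:R + 2 * k%:R + 3) * (2 * n%:R + 1) ^+ 2).
Proof.
elim: k => [|k IH]; first by rewrite !hterm0; ring.
have e1 := htermS n k; have e2 := htermS n.+1 k.
have h1 := odd_sub_even_neq0 k n.
have h1' := odd_sub_even_neq0 k n.+1.
have h2 : k%:R + 1 != 0 :> rat by rewrite natr1 pnatr_eq0.
have n0 : 0 <= n%:R :> rat by []. have k0 : 0 <= k%:R :> rat by [].
have h3 : 2 * n%:R + 2 * k%:R + 3 != 0 :> rat.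
  by apply/eqP=> ?; lra.
have h5 : 2 * n%:R + 2 * k%:R + 5 != 0 :> rat.
  by apply/eqP=> ?; lra.
have h6 : 2 * n%:R + 2 * k%:R + 2 != 0 :> rat.
  by apply/eqP=> ?; lra.
have h7 := odd_sub_even_neq0 n k.
have h8 : 2 * n%:R + 1 != 0 :> rat by apply/eqP=> ?; lra.
have h9 : 2 * n%:R + 3 != 0 :> rat by apply/eqP=> ?; lra.
rewrite -[n.+1%:R]natr1 in h1' e2; rewrite -[k.+1%:R]natr1.
set N := n%:R in n0 e1 e2 IH h1 h1' h3 h5 h6 h7 h8 h9 *;
  set K := k%:R in k0 e1 e2 IH h1 h1' h2 h3 h5 h6 h7 *.
set A := hterm n k in e1 IH *; set B := hterm n.+1 k in e2 IH *.
set A' := hterm n k.+1 in e1 *; set B' := hterm n.+1 k.+1 in e2 *.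
have -> : A' = A * ((2 * K + 1) * (2 * N - 2 * K) * (2 * N + 2 * K + 2)) /
  (2 * (K + 1) * (2 * N + 2 * K + 3) * (2 * K + 1 - 2 * N)).
  by rewrite -e1; field; rewrite h1 h2 h3.
have -> : B' = B * ((2 * K + 1) * (2 * (N + 1) - 2 * K) * (2 * (N + 1) + 2 * K + 2)) /
  (2 * (K + 1) * (2 * (N + 1) + 2 * K + 3) * (2 * K + 1 - 2 * (N+1))).
  by rewrite -e2; field; nz.
have -> : A = B * ((2 * N + 2 - 2 * K) * (2 * N + 2 * K + 3) * (2 * N + 1) ^+ 2) /
  ((2 * N + 1) * (2 * N + 2 * K + 2) * (2 * N + 1 - 2 * K)
     * (2 * N + 3)).
  by rewrite -IH; field; rewrite h6 h7 h8 h9.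
field; nz.
Qed.

Definition hmoment (n : nat) (w : nat -> rat) : rat :=
  \sum_(k < n.+1) w k * hterm n k.

Lemma hmoment_widen n m (w : nat -> rat) : (n < m)%N -> \sum_(k < m) w k * hterm n k =
  hmoment n w.
Proof.
move=> lt; rewrite /hmoment (big_ord_widen m (fun k => w k * hterm n k) lt).
rewrite [RHS]big_mkcond /=; apply: eq_bigr => k _; case: ifPn => //.
by rewrite -leqNgt => ?; rewrite hterm_gt ?mulr0.
Qed.

Lemma htermSE n k : hterm n k.+1
  = hterm n k * ((2 * k%:R + 1) * (2 * n%:R - 2 * k%:R) * (2 * n%:R + 2 * k%:R + 2)) /
    (2 * (k%:R + 1) * (2 * n%:R + 2 * k%:R + 3) * (2 * k%:R + 1 - 2 * n%:R)).
Proof.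
have h1 := odd_sub_even_neq0 k n.
have n0 : 0 <= n%:R :> rat by []. have k0 : 0 <= k%:R :> rat by [].
by rewrite -htermS mulfK // !mulf_neq0 //; nz.
Qed.

Lemma htermnE n k : hterm n k
  = hterm n.+1 k * ((2 * n%:R + 2 - 2 * k%:R) * (2 * n%:R + 2 * k%:R + 3) * (2 * n%:R + 1))
   / ((2 * n%:R + 2 * k%:R + 2) * (2 * n%:R + 1 - 2 * k%:R) * (2 * n%:R + 3)).
Proof.
have h1 := odd_sub_even_neq0 n k; have e := htermSn n k.
have n0 : 0 <= n%:R :> rat by []. have k0 : 0 <= k%:R :> rat by [].
have h2 : 2 * n%:R + 1 != 0 :> rat by nz.
apply: (mulIf h2).
apply: (mulIf (_ : (2 * n%:R + 2 * k%:R + 2) * (2 * n%:R + 1 - 2 * k%:R) * (2 * n%:R + 3) != 0)).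
  by rewrite !mulf_neq0 //; nz.
transitivity (hterm n.+1 k * ((2 * n%:R + 2 - 2 * k%:R) * (2 * n%:R + 2 * k%:R + 3) * (2 * n%:R
  + 1) ^+ 2)).
  by rewrite -e; ring.
by field; nz.
Qed.

Lemma sum_telescope m (F : 'I_m -> rat) (G : nat -> rat) :
  (forall k : 'I_m, F k = G k.+1 - G k) -> \sum_(k < m) F k = G m - G 0%N.
Proof.
move=> FG; rewrite -telescope_sumr // big_mkord.
exact: eq_bigr.
Qed.

(* Here and below [G] is a certificate found by Zeilberger's algorithm,
   rewritten in terms of the highest [hterm] so that it has no pole at [k = n + 1]. *)
Lemma moment_quadratic n :
  (2 * n%:R + 1) * (4 * n%:R + 3) * (4 * n%:R + 5) * hmoment n.+1 (fun=> 1)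
  = (2 * n%:R + 3) * hmoment n
    (fun k => 16 * n%:R ^+ 2 + 16 * n%:R + 1 - 16 * k%:R - 32 * k%:R ^+ 2).
Proof.
pose w k : rat := 16 * n%:R ^+ 2 + 16 * n%:R + 1 - 16 * k%:R - 32 * k%:R ^+ 2.
pose G k := - (16 * k%:R - 4) * k%:R * (2 * n%:R + 2 * k%:R + 3) * (2 * n%:R + 1) /
  (2 * n%:R + 2 * k%:R + 2)
     * hterm n.+1 k.
apply/eqP; rewrite -subr_eq0 -(@hmoment_widen n.+1 n.+2) // -(@hmoment_widen n n.+2) //.
rewrite !mulr_sumr -sumrB (@sum_telescope _ _ G).
  by rewrite /G hterm_gt // !(mulr0, mul0r) subrr.
move=> k; rewrite /G htermSE (htermnE n) -[k.+1%:R]natr1 -[n.+1%:R]natr1.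
have h1 := odd_sub_even_neq0 k n.+1; have h2 := odd_sub_even_neq0 n k.
rewrite -[n.+1%:R]natr1 in h1.
have n0 : 0 <= n%:R :> rat by []. have k0 : 0 <= k%:R :> rat by [].
move: (n%:R) (k%:R) (hterm _ _) n0 k0 h1 h2 => N K A n0 k0 h1 h2.
field; nz.
Qed.

(** The series is well poised with [a = 1/2], and [4 k + 1] is its very-well-poised factor
    [(a + 2 k) / a]; this is Whipple's summation of a [4F3] at [-1]. It is the source of the term
    [eps p]. *)
Lemma moment_linear n :
  hmoment n (fun k => 4 * k%:R + 1) = (-1) ^+ n * (2 * n%:R + 1).
Proof.
elim: n => [|n IH]; first by rewrite /hmoment big_ord_recl big_ord0 hterm0 expr0 !mulr0n !mulr0
  !addr0 add0r !mulr1.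
have n0 : 0 <= n%:R :> rat by [].
have h : 2 * n%:R + 1 != 0 :> rat by nz.
apply: (mulfI h); rewrite exprS -[n.+1%:R]natr1.
suff e : (2 * n%:R + 1) * hmoment n.+1 (fun k => 4 * k%:R + 1)
    + (2 * n%:R + 3) * hmoment n (fun k => 4 * k%:R + 1) = 0.
  by apply/eqP; rewrite -subr_eq0 -e IH; apply/eqP; ring.
pose G k := - 4 * k%:R * (2 * n%:R + 2 * k%:R + 3) * (2 * n%:R + 1) / (2 * n%:R + 2 * k%:R + 2)
     * hterm n.+1 k.
rewrite -(@hmoment_widen n.+1 n.+2) // -(@hmoment_widen n n.+2) //.
rewrite !mulr_sumr -big_split /= (@sum_telescope _ _ G).
  by rewrite /G hterm_gt // !(mulr0, mul0r) subrr.
move=> k; rewrite /G htermSE (htermnE n) -[k.+1%:R]natr1 -[n.+1%:R]natr1.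
have h1 := odd_sub_even_neq0 k n.+1; have h2 := odd_sub_even_neq0 n k.
rewrite -[n.+1%:R]natr1 in h1.
have k0 : 0 <= k%:R :> rat by [].
move: (n%:R) (k%:R) (hterm _ _) n0 k0 h h1 h2 => N K A n0 k0 h h1 h2.
field; nz.
Qed.

(** The shape of the closed form depends on the parity of [n], so the recurrence links [n] to
    [n + 2]. *)
Lemma moment_const_step2 n :
  (2 * n%:R + 1) * (4 * n%:R + 7) * (4 * n%:R + 9) * hmoment n.+2 (fun=> 1)
  = (2 * n%:R + 5) * (4 * n%:R + 5) * (4 * n%:R + 3) * hmoment n (fun=> 1).
Proof.
pose G k := - 8 * (2 * n%:R + 3) * (1 - 4 * k%:R) * k%:R * (2 * n%:R + 2 * k%:R + 5) *
  (2 * n%:R + 1)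
      / ((2 * n%:R + 2 * k%:R + 2) * (2 * n%:R + 2 * k%:R + 4) * (2 * n%:R + 3 - 2 * k%:R))
     * hterm n.+2 k.
apply/eqP; rewrite -subr_eq0 -(@hmoment_widen n.+2 n.+3) // -(@hmoment_widen n n.+3) //;
  last exact: ltnW.
rewrite !mulr_sumr -sumrB (@sum_telescope _ _ G).
  by rewrite /G hterm_gt // !(mulr0, mul0r) subrr.
move=> k; rewrite /G htermSE (htermnE n) (htermnE n.+1).
rewrite -[k.+1%:R]natr1 -[n.+2%:R]natr1 -[n.+1%:R]natr1.
have h1 := odd_sub_even_neq0 k n.+2; have h2 := odd_sub_even_neq0 n k.
have h3 := odd_sub_even_neq0 n.+1 k; have h4 := odd_sub_even_neq0 k n.+1.
rewrite -[n.+2%:R]natr1 -[n.+1%:R]natr1 in h1.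
rewrite -[n.+1%:R]natr1 in h3. rewrite -[n.+1%:R]natr1 in h4.
have n0 : 0 <= n%:R :> rat by []. have k0 : 0 <= k%:R :> rat by [].
move: (n%:R) (k%:R) (hterm _ _) n0 k0 h1 h2 h3 h4 => N K A n0 k0 h1 h2 h3 h4.
have h5 : 2 * N + 3 - 2 * K != 0.
  by apply/eqP => h; move/eqP: h3; apply; lra.
have h6 : 2 * N + 3 - 2 * (K + 1) != 0.
  by apply/eqP => h; move/eqP: h2; apply; lra.
field; nz.
Qed.

(** At [k + 1] the polynomial factor of [G] cancels the factor [4 (k + 1) ^ 2 - P ^ 2] in the
    denominator of [trat], so that only [1 / (k + 1)] survives. The boundary term at [k = 0] is
    [P ^ 2 / 4], negligible modulo [p ^ 2]. *)
Lemma moment_inv n :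
  - 2 * hmoment n (fun k => k%:R ^+ 2) - 2^-1 * hmoment n (fun k => k%:R)
   + (2 * n%:R ^+ 2 + 2 * n%:R + 4^-1) * hmoment n (fun=> 1)
   - n%:R * (n%:R + 1) / 2 * hmoment n (fun k => (k%:R + 1)^-1)
  = (n%:R + 2^-1) ^+ 2.
Proof.
pose G k := (k%:R ^+ 2 - (n%:R + 2^-1) ^+ 2) * hterm n k.
rewrite !mulr_sumr -sumrB -big_split /= -sumrB (@sum_telescope _ _ G).
  by rewrite /G hterm_gt // hterm0; ring.
move=> k; rewrite /G htermSE -[k.+1%:R]natr1.
have h1 := odd_sub_even_neq0 k n.
have n0 : 0 <= n%:R :> rat by []. have k0 : 0 <= k%:R :> rat by [].
move: (n%:R) (k%:R) (hterm _ _) n0 k0 h1 => N K A n0 k0 h1.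
field; nz.
Qed.

(** By the two-step recurrence the product of consecutive values is rational in [n], although the
    values are not. It eliminates [hmoment n.+1] from [moment_quadratic]. *)
Lemma hmoment_consecutive n :
  (4 * n%:R + 3) * (4 * n%:R + 5) * hmoment n (fun=> 1) * hmoment n.+1 (fun=> 1)
  = (2 * n%:R + 1) * (2 * n%:R + 3).
Proof.
elim: n => [|n IH].
  have h0 : hmoment 0 (fun=> 1) = 1.
    by rewrite /hmoment big_ord_recl big_ord0 hterm0 mulr1 addr0.
  have := moment_quadratic 0; rewrite h0.
  have -> : hmoment 0 (fun k => 16 * 0%:R ^+ 2 + 16 * 0%:R + 1 - 16 * k%:R - 32 * k%:R ^+ 2) = 1.
    by rewrite /hmoment big_ord_recl big_ord0 hterm0 !mulr0n !expr0n /= !mulr0; ring.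
  by rewrite mulr0n => e; lra.
have n0 : 0 <= n%:R :> rat by [].
have h : 2 * n%:R + 1 != 0 :> rat by nz.
apply: (mulfI h).
have e := moment_const_step2 n.
rewrite -[n.+1%:R]natr1.
transitivity ((2 * n%:R + 5) * ((4 * n%:R + 3) * (4 * n%:R + 5) * hmoment n (fun=> 1) * hmoment
  n.+1 (fun=> 1))).
  transitivity (hmoment n.+1 (fun=> 1) * ((2 * n%:R + 1) * (4 * n%:R + 7) * (4 * n%:R + 9) *
    hmoment n.+2 (fun=> 1))).
    by ring.
  by rewrite e; ring.
by rewrite IH; ring.
Qed.

(** For [p = 2 n + 1] the right side is [p ^ 2]: once [T] is known to be a unit at [p], the
    quadratic moment vanishes modulo [p ^ 2], which determines the second moment from the first and
    [T]. *)
Lemma moment_quadratic_mul n :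
  hmoment n (fun k => 16 * n%:R ^+ 2 + 16 * n%:R + 1 - 16 * k%:R - 32 * k%:R ^+ 2) * hmoment n
    (fun=> 1)
  = (2 * n%:R + 1) ^+ 2.
Proof.
have n0 : 0 <= n%:R :> rat by [].
have h : 2 * n%:R + 3 != 0 :> rat by nz.
apply: (mulfI h); rewrite mulrA -moment_quadratic.
transitivity ((2 * n%:R + 1) * ((4 * n%:R + 3) * (4 * n%:R + 5) * hmoment n (fun=> 1) * hmoment
  n.+1 (fun=> 1))).
  by ring.
by rewrite hmoment_consecutive; ring.
Qed.

Lemma hmoment_even m :
  hmoment m.*2 (fun=> 1) * \prod_(i < m) ((8 * i%:R + 7) * (8 * i%:R + 9))
  = (4 * m%:R + 1) * \prod_(i < m) ((8 * i%:R + 3) * (8 * i%:R + 5)).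
Proof.
elim: m => [|m IH].
  by rewrite /hmoment big_ord_recl !big_ord0 hterm0 mulr0n; ring.
have e := moment_const_step2 m.*2.
rewrite doubleS !big_ord_recr /=.
have m0 : 0 <= m%:R :> rat by [].
have h : 4 * m%:R + 1 != 0 :> rat by nz.
apply: (mulfI h).
rewrite -mul2n natrM in e; rewrite -[m.+1%:R]natr1.
rewrite -mul2n in IH *.
set P := \prod_(_ < _) _ in IH *; set Q := \prod_(_ < _) _ in IH *.
move: (hmoment (2 * m).+2 _) (hmoment (2 * m) _) P Q (m%:R) m0 h e IH => T2 T0 P Q M m0 h e IH.
transitivity (P * ((2 * (2 * M) + 1) * (4 * (2 * M) + 7) * (4 * (2 * M) + 9) * T2));
  first by ring.
rewrite e; transitivity ((4 * M + 5) * (8 * M + 5) * (8 * M + 3) * (T0 * P)); first by ring.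
by rewrite IH; ring.
Qed.

Lemma hmoment_odd m :
  hmoment m.*2.+1 (fun=> 1) * \prod_(i < m.+1) ((8 * i%:R + 3) * (8 * i%:R + 5))
  = (4 * m%:R + 3) * \prod_(i < m) ((8 * i%:R + 7) * (8 * i%:R + 9)).
Proof.
elim: m => [|m IH].
  have := hmoment_consecutive 0; rewrite big_ord1 big_ord0 /= !mulr0n.
  have -> : hmoment 0 (fun=> 1) = 1.
    by rewrite /hmoment big_ord_recl big_ord0 hterm0 mulr1 addr0.
  by lra.
have e := moment_const_step2 m.*2.+1.
rewrite doubleS big_ord_recr [in RHS]big_ord_recr /=.
have m0 : 0 <= m%:R :> rat by [].
have h : 4 * m%:R + 3 != 0 :> rat by nz.
apply: (mulfI h).
rewrite -[m.*2.+1%:R]natr1 -mul2n natrM in e; rewrite -[m.+1%:R]natr1.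
rewrite -mul2n in IH *.
set P := \prod_(_ < _) _ in IH *; set Q := \prod_(_ < _) _ in IH *.
move: (hmoment (2 * m).+3 _) (hmoment (2 * m).+1 _) P Q (m%:R) m0 h e IH => T2 T0 P Q M m0 h e IH.
transitivity (P * ((2 * (2 * M + 1) + 1) * (4 * (2 * M + 1) + 7) * (4 * (2 * M + 1) + 9) *
  T2)); first by ring.
rewrite e; transitivity ((4 * M + 7) * (8 * M + 9) * (8 * M + 7) * (T0 * P)); first by ring.
by rewrite IH; ring.
Qed.

(** * Congruences between p-integral rationals *)

Section Congruences.
Variable p : nat.
Hypothesis pp : prime p.

Definition pint (x : rat) : Prop :=
  exists c d : int, ~~ (p%:Z %| d)%Z /\ x = c%:~R / d%:~R.

Definition punit (x : rat) : Prop := x != 0 /\ pint x /\ pint x^-1.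

Local Notation "x ≡ y 'mod' r" := (rat_congr_pow p r x y) (at level 70, y at next level).

Lemma dvdz_primeM (c d : int) : (p%:Z %| c * d)%Z = (p%:Z %| c)%Z || (p%:Z %| d)%Z.
Proof. by rewrite !dvdzE abszM /= Euclid_dvdM. Qed.

Lemma ndvdz_neq0 (d : int) : ~~ (p%:Z %| d)%Z -> d%:~R != 0 :> rat.
Proof. by apply: contraNN; rewrite intr_eq0 => /eqP ->; rewrite dvdz0. Qed.

Lemma p_neq0 : p%:R != 0 :> rat.
Proof. by rewrite pnatr_eq0 -lt0n prime_gt0. Qed.

Lemma pint_int (c : int) : pint c%:~R.
Proof.
exists c, 1; rewrite divr1; split=> //.
by rewrite dvdzE /= dvdn1; case: p pp => [|[]].
Qed.

Lemma pint_nat n : pint n%:R.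
Proof. by rewrite pmulrn; apply: pint_int. Qed.

Lemma pint0 : pint 0. Proof. exact: (pint_nat 0). Qed.
Lemma pint1 : pint 1. Proof. exact: (pint_nat 1). Qed.

Lemma pintD x y : pint x -> pint y -> pint (x + y).
Proof.
case=> c [d [hd ->]] [c' [d' [hd' ->]]].
exists (c * d' + c' * d), (d * d'); rewrite dvdz_primeM negb_or hd; split=> //.
by rewrite rmorphD !rmorphM /=; field; rewrite !ndvdz_neq0.
Qed.

Lemma pintM x y : pint x -> pint y -> pint (x * y).
Proof.
case=> c [d [hd ->]] [c' [d' [hd' ->]]].
exists (c * c'), (d * d'); rewrite dvdz_primeM negb_or hd; split=> //.
by rewrite !rmorphM /=; field; rewrite !ndvdz_neq0.
Qed.

Lemma pintN x : pint x -> pint (- x).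
Proof. by move=> h; rewrite -mulN1r; apply: pintM => //; apply: (pint_int (-1)). Qed.

Lemma pintB x y : pint x -> pint y -> pint (x - y).
Proof. by move=> hx hy; apply: pintD => //; apply: pintN. Qed.

Lemma pintX x n : pint x -> pint (x ^+ n).
Proof. by move=> h; elim: n => [|n IH]; [exact: pint1 | rewrite exprS; apply: pintM]. Qed.

Lemma pint_sum I (r : seq I) (P : pred I) F :
  (forall i, P i -> pint (F i)) -> pint (\sum_(i <- r | P i) F i).
Proof. by move=> h; elim/big_rec: _ => [|i x Pi hx]; [exact: pint0 | apply: pintD => //;
  apply: h]. Qed.

Lemma punit_int (d : int) : ~~ (p%:Z %| d)%Z -> punit d%:~R.
Proof.
move=> hd; split; first exact: ndvdz_neq0.
by split; [exact: pint_int | exists 1, d; rewrite div1r].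
Qed.

Lemma punit_nat (d : nat) : ~~ (p %| d)%N -> punit d%:R.
Proof. by move=> h; rewrite pmulrn; apply: punit_int; rewrite dvdzE. Qed.

Lemma punit_lt (d : nat) : (0 < d < p)%N -> punit d%:R.
Proof. by case/andP=> d0 dp; apply: punit_nat; rewrite gtnNdvd. Qed.

Lemma punit_pint x : punit x -> pint x. Proof. by case=> _ []. Qed.
Lemma punitV x : punit x -> punit x^-1.
Proof. by case=> x0 [h1 h2]; split; [rewrite invr_eq0 | rewrite invrK]. Qed.
Lemma punitM x y : punit x -> punit y -> punit (x * y).
Proof.
case=> x0 [x1 x2] [y0 [y1 y2]]; split; first by rewrite mulf_neq0.
by split; rewrite ?invfM; apply: pintM.
Qed.
Lemma punit1 : punit 1.
Proof. by split; [exact: oner_neq0 | split; rewrite ?invr1; exact: pint1]. Qed.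
Lemma punit_prod I (r : seq I) (P : pred I) F :
  (forall i, P i -> punit (F i)) -> punit (\prod_(i <- r | P i) F i).
Proof. by move=> h; elim/big_rec: _ => [|i x Pi hx]; [exact: punit1 | apply: punitM => //;
  apply: h]. Qed.
Lemma punitX x n : punit x -> punit (x ^+ n).
Proof. by move=> h; elim: n => [|n IH]; [exact: punit1 | rewrite exprS; apply: punitM]. Qed.
Lemma punitN x : punit x -> punit (- x).
Proof.
case=> x0 [h1 h2]; split; first by rewrite oppr_eq0.
by split; rewrite ?invrN; apply: pintN.
Qed.

Lemma congP r x y : x ≡ y mod r <-> exists2 u, pint u & x - y = (p ^ r)%:R * u.
Proof.
split=> [[c [d [hd e]]]|[u [c [d [hd ->]]] e]]; last by exists c, d.
by exists (c%:~R / d%:~R) => //; exists c, d.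
Qed.

Lemma cong_refl r x : x ≡ x mod r.
Proof. by apply/congP; exists 0; [exact: pint0 | rewrite subrr mulr0]. Qed.

Lemma cong_sym r x y : x ≡ y mod r -> y ≡ x mod r.
Proof.
case/congP=> u hu e; apply/congP; exists (- u); first exact: pintN.
by rewrite -opprB e mulrN.
Qed.

Lemma cong_trans r y x z : x ≡ y mod r -> y ≡ z mod r -> x ≡ z mod r.
Proof.
case/congP=> u hu e /congP[v hv e']; apply/congP; exists (u + v); first exact: pintD.
by rewrite mulrDr -e -e' addrA subrK.
Qed.

Lemma congD r x x' y y' : x ≡ x' mod r -> y ≡ y' mod r -> x + y ≡ x' + y' mod r.
Proof.
case/congP=> u hu e /congP[v hv e']; apply/congP; exists (u + v); first exact: pintD.
by rewrite mulrDr -e -e'; ring.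
Qed.

Lemma congM r x x' y y' : pint x' -> pint y ->
  x ≡ x' mod r -> y ≡ y' mod r -> x * y ≡ x' * y' mod r.
Proof.
move=> hx hy /congP[u hu e] /congP[v hv e']; apply/congP; exists (u * y + x' * v).
  by apply: pintD; apply: pintM.
have -> : x = x' + (p ^ r)%:R * u by rewrite -e; ring.
have -> : y' = y - (p ^ r)%:R * v by rewrite -e'; ring.
by ring.
Qed.

Lemma congMl r c x y : pint c -> x ≡ y mod r -> c * x ≡ c * y mod r.
Proof.
move=> hc /congP[u hu e]; apply/congP; exists (c * u); first exact: pintM.
by rewrite -mulrBr e; ring.
Qed.

Lemma congMr r c x y : pint c -> x ≡ y mod r -> x * c ≡ y * c mod r.
Proof. by rewrite ![_ * c]mulrC; apply: congMl. Qed.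

Lemma congN r x y : x ≡ y mod r -> - x ≡ - y mod r.
Proof. by move=> h; rewrite -[- x]mulN1r -[- y]mulN1r; apply: congMl => //;
  exact: (pint_int (-1)). Qed.

Lemma congB r x x' y y' : x ≡ x' mod r -> y ≡ y' mod r -> x - y ≡ x' - y' mod r.
Proof. by move=> h1 h2; apply: congD => //; apply: congN. Qed.

Lemma congIr r c x y : punit c -> x * c ≡ y * c mod r -> x ≡ y mod r.
Proof.
case=> c0 [_ hc] /(congMr hc); by rewrite !mulfK.
Qed.

Lemma cong_sum r I (s : seq I) (P : pred I) F G :
  (forall i, P i -> F i ≡ G i mod r) -> \sum_(i <- s | P i) F i ≡ \sum_(i <- s | P i) G i mod r.
Proof. by move=> h; elim/big_rec2: _ => [|i x y Pi hx]; [exact: cong_refl | apply: congD => //;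
  apply: h]. Qed.

Lemma cong_pS r x y : x ≡ y mod r -> p%:R * x ≡ p%:R * y mod r.+1.
Proof.
case/congP=> u hu e; apply/congP; exists u => //.
by rewrite -mulrBr e expnS natrM mulrA.
Qed.

Lemma cong_W r x y : x ≡ y mod r.+1 -> x ≡ y mod r.
Proof.
case/congP=> u hu e; apply/congP; exists (p%:R * u); first by apply: pintM => //; apply: pint_nat.
by rewrite e expnSr natrM mulrA.
Qed.

Lemma cong_pX r u : pint u -> (p ^ r)%:R * u ≡ 0 mod r.
Proof. by move=> hu; apply/congP; exists u => //; rewrite subr0. Qed.

Lemma cong_int r (c d : int) : (c%:~R ≡ d%:~R mod r) <-> ((p ^ r)%:Z %| c - d)%Z.
Proof.
split; last first.
  case/dvdzP=> k e; apply/congP; exists k%:~R; first exact: pint_int.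
  by rewrite -rmorphB /= e rmorphM /= mulrC.
case=> e [f [hf]] h; have f0 := ndvdz_neq0 hf.
have {h} : f * (c - d) = (p ^ r)%:Z * e.
  apply: (@intr_inj rat); rewrite !rmorphM rmorphB /= h -[((p ^ r)%:Z)%:~R]/((p ^ r)%:R).
  by field.
move=> h; have : ((p ^ r)%:Z %| f * (c - d))%Z by rewrite h dvdz_mulr.
rewrite Gauss_dvdzr //; rewrite coprimezE /= coprimeXl // prime_coprime //.
Qed.

(** First order expansion of a product: cross terms between the [p z i] carry [p ^ 2]. The sums of
    [z] will be harmonic sums. *)
Lemma cong_prod_1p I (s : seq I) (P : pred I) F x z :
  (forall i, P i -> pint (x i)) -> (forall i, P i -> pint (z i)) ->
  (forall i, P i -> F i ≡ x i * (1 + p%:R * z i) mod 2) ->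
  \prod_(i <- s | P i) F i ≡ (\prod_(i <- s | P i) x i) * (1 + p%:R * \sum_(i <- s | P i) z i)
    mod 2.
Proof.
move=> hx hz hF.
suff : [/\ pint (\prod_(i <- s | P i) x i), pint (\sum_(i <- s | P i) z i)
  & \prod_(i <- s | P i) F i ≡ (\prod_(i <- s | P i) x i) *
    (1 + p%:R * \sum_(i <- s | P i) z i) mod 2] by case.
elim/big_rec3: _ => [|i a c b Pi [hb ha h]].
  by split; [exact: pint1|exact: pint0|rewrite mulr0 addr0 mulr1; exact: cong_refl].
split; [by apply: pintM => //; apply: hx|by apply: pintD => //; apply: hz|].
have hp : pint p%:R by exact: pint_nat.
have h1 u : pint u -> pint (1 + p%:R * u) by move=> ?; apply: pintD; [exact: pint1|apply: pintM].
apply: (@cong_trans _ (x i * (1 + p%:R * z i) * (b * (1 + p%:R * a)))).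
  apply: congM => //; last exact: hF.
    by apply: pintM; [exact: hx|apply: h1; apply: hz].
  have -> : c = (c - b * (1 + p%:R * a)) + b * (1 + p%:R * a) by ring.
  case/congP: h => u hu ->; apply: pintD; last by apply: pintM => //; apply: h1.
  by apply: pintM => //; apply: pint_nat.
apply/congP; exists (x i * b * z i * a).
  by do !apply: pintM => //; [exact: hx|exact: hz].
by rewrite natrX; ring.
Qed.

Lemma cong_prod_nat m n F (x z : nat -> rat) :
  (forall s, (m <= s < n)%N -> pint (x s)) -> (forall s, (m <= s < n)%N -> pint (z s)) ->
  (forall s, (m <= s < n)%N -> F s ≡ x s * (1 + p%:R * z s) mod 2) ->
  \prod_(m <= s < n) F s ≡ (\prod_(m <= s < n) x s) * (1 + p%:R * \sum_(m <= s < n) z s) mod 2.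
Proof.
by move=> *; rewrite big_nat [\prod_(_ <= _ < _) x _]big_nat [\sum_(_ <= _ < _) _]big_nat;
  apply: cong_prod_1p.
Qed.

Lemma cong_mul_1p A B a b u v : pint a -> pint b -> pint u -> pint v ->
  A ≡ a * (1 + p%:R * u) mod 2 -> B ≡ b * (1 + p%:R * v) mod 2 ->
  A * B ≡ a * b * (1 + p%:R * (u + v)) mod 2.
Proof.
move=> ha hb hu hv hA hB.
have hp : pint p%:R by exact: pint_nat.
have h1 w : pint w -> pint (1 + p%:R * w) by move=> ?; apply: pintD; [exact: pint1|apply: pintM].
apply: (@cong_trans _ (a * (1 + p%:R * u) * (b * (1 + p%:R * v)))).
  apply: congM => //; first by apply: pintM => //; apply: h1.
  have -> : B = (B - b * (1 + p%:R * v)) + b * (1 + p%:R * v) by ring.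
  case/congP: hB => w hw ->; apply: pintD; last by apply: pintM => //; apply: h1.
  by apply: pintM => //; apply: pint_nat.
apply/congP; exists (a * b * u * v); first by do !apply: pintM => //.
by rewrite natrX; ring.
Qed.

Lemma punit_cong1 x y : x ≡ y mod 1 -> punit y -> punit x.
Proof.
case/congP=> u hu exy uy; have [y0 [hy hyi]] := uy.
have hx : pint x.
  have -> : x = p%:R * u + y by rewrite -[p%:R * u](_ : x - y = _) ?subrK // exy expn1.
  by apply: pintD => //; apply: pintM => //; exact: pint_nat.
case: (hx) => c [d [hd ex]]; have d0 := ndvdz_neq0 hd.
have hc : ~~ (p%:Z %| c)%Z.
  apply/negP => /dvdzP[k ek].
  have e1 : 1 ≡ 0 mod 1.
    apply/congP; exists ((k%:~R / d%:~R - u) * y^-1).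
      apply: pintM => //; apply: pintB => //; by exists k, d.
    have ey : y = p%:R * (k%:~R / d%:~R - u).
      rewrite expn1 in exy; rewrite mulrBr -exy ex ek rmorphM /=.
      by rewrite -[(Posz p)%:~R]/(p%:R); field.
    by rewrite subr0 expn1 mulrA -ey mulfV.
  have := (cong_int 1 1 0).1 e1; rewrite expn1 subr0 dvdzE /= dvdn1.
  by case: p pp => [|[]].
have c0 := ndvdz_neq0 hc.
split; first by rewrite ex mulf_neq0 ?invr_eq0.
by split=> //; exists d, c; rewrite ex invf_div.
Qed.

Lemma punit_cong r x y : x ≡ y mod r.+1 -> punit y -> punit x.
Proof.
elim: r => [|r IH]; first exact: punit_cong1.
by move=> h; apply: IH; apply: cong_W.
Qed.

Lemma punit_1p u : pint u -> punit (1 + p%:R * u).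
Proof.
move=> hu; apply: (@punit_cong 0 _ 1); last exact: punit1.
by apply/congP; exists u; rewrite // expn1 addrAC subrr add0r.
Qed.

End Congruences.

(** * The closed form modulo p^2 *)

Definition harm (n : nat) : rat := \sum_(0 <= s < n) s.+1%:R^-1.

(* Numerator and denominator of the closed form, with the factors [8 i + c] written as
   [8 s - j p] so that they can be compared with factorials modulo [p]. *)
Definition hnum (p f g n : nat) : rat :=
  \prod_(f <= s < g) (3 * p%:R - 8 * s.+1%:R) *
  \prod_(g <= s < n) ((8 * s.+1%:R - 3 * p%:R) * (5 * p%:R - 8 * s.+1%:R)).

Definition hden (p f g : nat) : rat :=
  \prod_(0 <= s < f) (p%:R ^+ 2 - 64 * s.+1%:R ^+ 2) *
  \prod_(f <= s < g) (8 * s.+1%:R - p%:R).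

Lemma harmB f g : (f <= g)%N -> \sum_(f <= s < g) s.+1%:R^-1 = harm g - harm f.
Proof.
move=> le; rewrite /harm [in RHS](@big_cat_nat _ _ _ f) //=.
by rewrite addrAC subrr add0r.
Qed.

Lemma prod_bin f g : \prod_(g <= s < g + f) s.+1%:R =
  ('C(g + f, f))%:R * \prod_(0 <= s < f) s.+1%:R :> rat.
Proof.
have e m : \prod_(0 <= s < m) s.+1%:R = (m`!)%:R :> rat.
  by elim: m => [|m IH]; rewrite ?big_nil ?fact0 // big_nat_recr //= IH factS mulnC natrM.
have e2 : (g + f)`!%:R = g`!%:R * \prod_(g <= s < g + f) s.+1%:R :> rat.
  by rewrite -!e -big_cat_nat // leq_addr.
have g0 : g`!%:R != 0 :> rat by rewrite pnatr_eq0 -lt0n fact_gt0.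
apply: (mulfI g0); rewrite -e2 e mulrCA -!natrM -(bin_fact (leq_addl g f)) addnK.
by rewrite [(g`! * _)%N]mulnC.
Qed.

Lemma prod_shift (a m : nat) (F G : nat -> rat) :
  (forall i, (i < m)%N -> F (a + i)%N = G i) ->
  \prod_(a <= s < a + m) F s = \prod_(0 <= i < m) G i.
Proof.
move=> h; rewrite -{1}[a]add0n big_addn addKn !big_mkord.
by apply: eq_bigr => i _; rewrite -h 1?addnC.
Qed.

Lemma prod_shift_rev (a m : nat) (F G : nat -> rat) :
  (forall i, (i < m)%N -> F (a + i)%N = G (m.-1 - i)%N) ->
  \prod_(a <= s < a + m) F s = \prod_(0 <= i < m) G i.
Proof.
move=> h; rewrite (@prod_shift _ _ _ (fun i => G (m.-1 - i)%N)) //.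
rewrite !big_mkord (reindex_inj rev_ord_inj) /=; apply: eq_bigr => i _.
by congr G; have := ltn_ord i; lia.
Qed.

Lemma natr_lin (a b c : nat) : (a * b + c)%:R = a%:R * b%:R + c%:R :> rat.
Proof. by rewrite natrD natrM. Qed.

(* The factors at [f - 1 - s] and [f + 1 + s] are [p - 8 (s + 1)] and [p + 8 (s + 1)]. *)
Lemma prod_sym c f p : p = (8 * f + c)%N ->
  \prod_(0 <= i < f.*2.+1) (8 * i%:R + c%:R)
  = p%:R * \prod_(0 <= s < f) (p%:R ^+ 2 - 64 * s.+1%:R ^+ 2) :> rat.
Proof.
move=> ep; rewrite (@big_cat_nat _ _ _ f) //=; last by rewrite -addnn -addnS leq_addr.
rewrite [X in _ * X]big_ltn; last by rewrite -addnn ltnS leq_addr.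
rewrite mulrCA.
have -> : 8 * f%:R + c%:R = p%:R :> rat by rewrite ep natr_lin.
congr (_ * _); rewrite [X in X * _](_ : _ = \prod_(0 <= i < f) (p%:R - 8 * i.+1%:R)); last first.
  rewrite -[f in LHS]add0n; apply: prod_shift_rev => i lt.
  rewrite add0n ep natr_lin; have -> : ((f.-1 - i).+1 = f - i)%N by lia.
  rewrite natrB; last exact: ltnW.
  move: (f%:R) (i%:R) (c%:R) => F I C.
  ring.
rewrite [X in _ * X](_ : _ = \prod_(0 <= i < f) (p%:R + 8 * i.+1%:R)); last first.
  rewrite -addnn -addSn; apply: prod_shift => i lt.
  rewrite addSn -addnS ep natr_lin natrD.
  move: (f%:R) (i.+1%:R) (c%:R) => F I C; ring.
by rewrite -big_split /=; apply: eq_bigr => i _; ring.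
Qed.

(** Pairs each factor with its mirror image, so that [2 f] linear factors become [f] pairs, each
    attached to a single [s] in [hnum]. *)
Lemma prod_fold (m : nat) (F : nat -> rat) :
  \prod_(0 <= i < m + m) F i = \prod_(0 <= i < m) (F i * F (m + m.-1 - i)%N).
Proof.
rewrite (@big_cat_nat _ _ _ m) ?leq_addr //= big_split /=; congr (_ * _).
rewrite (@prod_shift_rev m m F (fun i => F (m + m.-1 - i)%N)) // => i lt.
by congr F; lia.
Qed.

Lemma hmoment_closed1 f p : p = (8 * f + 1)%N ->
  hmoment (4 * f) (fun=> 1) * hden p f (3 * f) = hnum p f (3 * f) (4 * f).
Proof.
move=> ep; have p0 : p%:R != 0 :> rat by rewrite pnatr_eq0 ep addn1.
have epR : p%:R = 8 * f%:R + 1 :> rat by rewrite ep natr_lin.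
(* For [m = 2 f] the factor [4 m + 1] is [p], and the product of the [8 i + 9] also contains a
   factor [p]; the two cancel, which leaves a unit at [p] on each side. *)
apply: (mulIf p0); have := hmoment_even (2 * f).
have -> : (2 * f).*2 = (4 * f)%N by lia.
have -> : 4 * (2 * f)%:R + 1 = p%:R :> rat by rewrite epR natrM; move: (f%:R) => F; ring.
rewrite -(big_mkord xpredT (fun i => (8 * i%:R + 7) * (8 * i%:R + 9))).
rewrite -(big_mkord xpredT (fun i => (8 * i%:R + 3) * (8 * i%:R + 5))) !big_split /=.
have -> : \prod_(0 <= i < 2 * f) (8 * i%:R + 9) =
  p%:R * \prod_(0 <= s < f) (p%:R ^+ 2 - 64 * s.+1%:R ^+ 2) :> rat.
  rewrite -(prod_sym ep) big_nat_recl // mulr0 add0r mul1r mul2n.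
  by apply: eq_bigr => i _; rewrite -[i.+1%:R]natr1; move: (i%:R) => I; ring.
have -> : \prod_(0 <= i < 2 * f) (8 * i%:R + 7) =
  \prod_(f <= s < 3 * f) (8 * s.+1%:R - p%:R) :> rat.
  have -> : (3 * f = f + 2 * f)%N by lia.
  rewrite (@prod_shift f (2 * f) _ (fun i => 8 * i%:R + 7)) // => i _.
  by rewrite -[(f + i).+1%:R]natr1 natrD epR; move: (f%:R) (i%:R) => F I; ring.
have -> : \prod_(0 <= i < 2 * f) (8 * i%:R + 3) =
  \prod_(f <= s < 3 * f) (3 * p%:R - 8 * s.+1%:R) :> rat.
  have -> : (3 * f = f + 2 * f)%N by lia.
  rewrite (@prod_shift_rev f (2 * f) _ (fun i => 8 * i%:R + 3)) // => i lt.
  have -> : ((2 * f).-1 - i = 2 * f - i.+1)%N by lia.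
  rewrite natrB // -[(f + i).+1%:R]natr1 natrD natrM epR -[i.+1%:R]natr1.
  by move: (f%:R) (i%:R) => F I; ring.
have -> : \prod_(0 <= i < 2 * f) (8 * i%:R + 5) =
  \prod_(3 * f <= s < 4 * f) ((8 * s.+1%:R - 3 * p%:R) * (5 * p%:R - 8 * s.+1%:R)) :> rat.
  have -> : (4 * f = 3 * f + f)%N by lia.
  rewrite mul2n -addnn prod_fold; symmetry; apply: prod_shift => i lt.
  have -> : (f + f.-1 - i = 2 * f - i.+1)%N by lia.
  rewrite natrB; last by lia.
  by rewrite -[(3 * f + i).+1%:R]natr1 -[i.+1%:R]natr1 natr_lin natrM epR;
    move: (f%:R) (i%:R) => F I; ring.
rewrite /hden /hnum => e.
rewrite [RHS]mulrC -e; ring.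
Qed.

Lemma hmoment_closed3 f p : p = (8 * f + 3)%N ->
  hmoment (4 * f).+1 (fun=> 1) * hden p f (3 * f).+1 = hnum p f (3 * f).+1 (4 * f).+1.
Proof.
move=> ep; have p0 : p%:R != 0 :> rat by rewrite pnatr_eq0 ep addnS.
have epR : p%:R = 8 * f%:R + 3 :> rat by rewrite ep natr_lin.
apply: (mulIf p0); have := hmoment_odd (2 * f).
have -> : (2 * f).*2.+1 = (4 * f).+1 by lia.
have -> : 4 * (2 * f)%:R + 3 = p%:R :> rat by rewrite epR natrM; move: (f%:R) => F; ring.
rewrite -(big_mkord xpredT (fun i => (8 * i%:R + 7) * (8 * i%:R + 9))).
rewrite -(big_mkord xpredT (fun i => (8 * i%:R + 3) * (8 * i%:R + 5))) !big_split /=.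
have -> : \prod_(0 <= i < (2 * f).+1) (8 * i%:R + 3) =
  p%:R * \prod_(0 <= s < f) (p%:R ^+ 2 - 64 * s.+1%:R ^+ 2) :> rat.
  by rewrite -(prod_sym ep) mul2n.
have -> : \prod_(0 <= i < (2 * f).+1) (8 * i%:R + 5) =
  \prod_(f <= s < (3 * f).+1) (8 * s.+1%:R - p%:R) :> rat.
  have -> : ((3 * f).+1 = f + (2 * f).+1)%N by lia.
  rewrite (@prod_shift f (2 * f).+1 _ (fun i => 8 * i%:R + 5)) // => i _.
  by rewrite -[(f + i).+1%:R]natr1 natrD epR; move: (f%:R) (i%:R) => F I; ring.
have -> : \prod_(0 <= i < 2 * f) (8 * i%:R + 9) =
  \prod_(f <= s < (3 * f).+1) (3 * p%:R - 8 * s.+1%:R) :> rat.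
  have -> : ((3 * f).+1 = f + (2 * f).+1)%N by lia.
  rewrite (@prod_shift_rev f (2 * f).+1 _ (fun i => 8 * i%:R + 1)) => [|i lt].
    rewrite big_nat_recl // mulr0 add0r mul1r.
    by apply: eq_bigr => i _; rewrite -[i.+1%:R]natr1; move: (i%:R) => I; ring.
  rewrite natrB; last by lia.
  by rewrite -[(f + i).+1%:R]natr1 natrD natrM epR; move: (f%:R) (i%:R) => F I; ring.
have -> : \prod_(0 <= i < 2 * f) (8 * i%:R + 7) =
  \prod_((3 * f).+1 <= s < (4 * f).+1) ((8 * s.+1%:R - 3 * p%:R) * (5 * p%:R - 8 * s.+1%:R)) :>
  rat.
  have -> : ((4 * f).+1 = (3 * f).+1 + f)%N by lia.
  rewrite mul2n -addnn prod_fold; symmetry; apply: prod_shift => i lt.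
  have -> : (f + f.-1 - i = 2 * f - i.+1)%N by lia.
  rewrite natrB; last by lia.
  by rewrite addSn -!natr1 natr_lin natrM epR; move: (f%:R) (i%:R) => F I; ring.
rewrite /hden /hnum => e.
rewrite [RHS]mulrC [X in p%:R * X]mulrC -e; ring.
Qed.

(** The coefficient of [p] in the logarithm of [hnum / hden]: [- 3/8] and [1/8] times
    [harm g - harm f] from the factors over [[f, g)], and [harm g - harm (g + f)] from the pairs
    over [[g, g + f)]. *)
Definition hcorr (f g : nat) : rat := - harm (g + f) + harm f / 4 + 3 * harm g / 4.

Section ClosedFormCong.
Variables (p f g : nat).
Hypotheses (pp : prime p) (le_fg : (f <= g)%N) (ep : p = (2 * (g + f) + 1)%N).

Lemma punit_small s : (s < g + f)%N -> punit p s.+1%:R.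
Proof. by move=> lt; apply: punit_lt => //; lia. Qed.

Lemma punit_pow2 k : punit p (2 ^+ k).
Proof. by apply: punitX => //; apply: punit_nat => //; rewrite gtnNdvd //;
  have := prime_gt1 pp; lia. Qed.

Lemma punit2 : punit p 2. Proof. exact: (punit_pow2 1). Qed.
Lemma punit4 : punit p 4. Proof. have -> : 4 = 2 ^+ 2 :> rat by []. exact: punit_pow2. Qed.
Lemma punit8 : punit p 8. Proof. have -> : 8 = 2 ^+ 3 :> rat by []. exact: punit_pow2. Qed.

Lemma pint_harm m : (m <= g + f)%N -> pint p (harm m).
Proof.
move=> le; rewrite /harm big_seq; apply: pint_sum => // s.
rewrite mem_index_iota => /andP[_ lt].
by apply: punit_pint; apply: punitV; apply: punit_small; apply: leq_trans le.
Qed.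

Lemma pint_hcorr : pint p (hcorr f g).
Proof.
have h4 := punit_pint (punitV punit4).
rewrite /hcorr; apply: pintD => //; first apply: pintD => //.
- by apply: pintN => //; apply: pint_harm.
- by apply: pintM => //; apply: pint_harm; apply: leq_addl.
- by apply: pintM => //; apply: pintM => //; [exact: pint_nat | apply: pint_harm;
  apply: leq_addr].
Qed.

Let pintu u : punit p u -> pint p u. Proof. exact: punit_pint. Qed.
Let hp : pint p p%:R. Proof. exact: pint_nat. Qed.
Let hi s : (s < g + f)%N -> pint p s.+1%:R^-1.
Proof. by move=> lt; apply: pintu; apply: punitV; apply: punit_small. Qed.
Let h8i : pint p 8^-1. Proof. exact: pintu (punitV punit8). Qed.

Lemma prod3_cong : rat_congr_pow p 2 (\prod_(f <= s < g) (3 * p%:R - 8 * s.+1%:R))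
   (\prod_(f <= s < g) (- 8 * s.+1%:R) * (1 + p%:R * (- (3 / 8) * (harm g - harm f)))).
Proof.
rewrite -(harmB le_fg) mulr_sumr; apply: cong_prod_nat => // s hs.
- by apply: pintM => //; [exact: (pint_int pp (-8)) | exact: pint_nat].
- apply: pintM => //; last by apply: hi; lia.
  by apply: pintN => //; apply: pintM => //; exact: pint_nat.
have s0 : s.+1%:R != 0 :> rat by rewrite pnatr_eq0.
rewrite (_ : _ - _ = - 8 * s.+1%:R * (1 + p%:R * (- (3 / 8) / s.+1%:R))); first exact: cong_refl.
by move: (p%:R) (s.+1%:R) s0 => P S s0; field.
Qed.

Lemma prod1_cong : rat_congr_pow p 2 (\prod_(f <= s < g) (8 * s.+1%:R - p%:R))
   (\prod_(f <= s < g) (8 * s.+1%:R) * (1 + p%:R * (- 8^-1 * (harm g - harm f)))).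
Proof.
rewrite -(harmB le_fg) mulr_sumr; apply: cong_prod_nat => // s hs.
- by apply: pintM => //; exact: pint_nat.
- by apply: pintM => //; [apply: pintN | apply: hi; lia].
have s0 : s.+1%:R != 0 :> rat by rewrite pnatr_eq0.
rewrite (_ : _ - _ = 8 * s.+1%:R * (1 + p%:R * (- 8^-1 / s.+1%:R))); first exact: cong_refl.
by move: (p%:R) (s.+1%:R) s0 => P S s0; field.
Qed.

Lemma prod2_cong : rat_congr_pow p 2
   (\prod_(g <= s < g + f) ((8 * s.+1%:R - 3 * p%:R) * (5 * p%:R - 8 * s.+1%:R)))
   (\prod_(g <= s < g + f) (- 64 * s.+1%:R ^+ 2) * (1 + p%:R * (- (harm (g + f) - harm g)))).
Proof.
rewrite -(harmB (leq_addr f g)) -sumrN; apply: cong_prod_nat => // s hs.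
- by apply: pintM => //; [exact: (pint_int pp (-64)) | apply: pintX => //; exact: pint_nat].
- by apply: pintN => //; apply: hi; lia.
have s0 : s.+1%:R != 0 :> rat by rewrite pnatr_eq0.
apply/congP; exists (- 15); first exact: (pint_int pp (-15)).
by rewrite natrX; move: (p%:R) (s.+1%:R) s0 => P S s0; field.
Qed.

Lemma prod0_cong : rat_congr_pow p 2
   (\prod_(0 <= s < f) (p%:R ^+ 2 - 64 * s.+1%:R ^+ 2))
   (\prod_(0 <= s < f) (- 64 * s.+1%:R ^+ 2) * (1 + p%:R * 0)).
Proof.
have e0 : \sum_(0 <= s < f) 0 = 0 :> rat by rewrite big1_eq.
rewrite -[X in 1 + p%:R * X]e0.
apply: cong_prod_nat => // s hs.
- by apply: pintM => //; [exact: (pint_int pp (-64)) | apply: pintX => //; exact: pint_nat].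
- exact: pint0.
apply/congP; exists 1; first exact: pint1.
by rewrite natrX; move: (p%:R) (s.+1%:R) => P S; ring.
Qed.

(** At leading order the factors over [[f, g)] cancel up to sign, and the squares over [[g, g + f)]
    divided by those over [[0, f)] give the squared binomial. *)
Lemma hmoment_cong_bin : hmoment (g + f) (fun=> 1) * hden p f g = hnum p f g (g + f) ->
  rat_congr_pow p 2 (hmoment (g + f) (fun=> 1))
    ((-1) ^+ (g - f) * ('C(g + f, f))%:R ^+ 2 * (1 + p%:R * hcorr f g)).
Proof.
set T := hmoment _ _ => eT.
have hgf : pint p (harm g - harm f) by apply: pintB => //; apply: pint_harm; lia.
have hngf : pint p (harm (g + f) - harm g) by apply: pintB => //; apply: pint_harm; lia.
pose x := \prod_(f <= s < g) (8 * s.+1%:R) : rat.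
pose y := \prod_(0 <= s < f) (- 64 * s.+1%:R ^+ 2) : rat.
have h64 : punit p (- 64).
  by have -> : -64 = - (2 ^+ 6) :> rat by []; apply: punitN => //; apply: punit_pow2.
have ux : punit p x.
  rewrite /x big_nat; apply: punit_prod => // s hs; apply: punitM => //; first exact: punit8.
  by apply: punit_small; lia.
have uy : punit p y.
  rewrite /y big_nat; apply: punit_prod => // s hs; apply: punitM => //.
  by apply: punitX => //; apply: punit_small; lia.
have ex : \prod_(f <= s < g) (- 8 * s.+1%:R) = (-1) ^+ (g - f) * x.
  rewrite /x -prodr_const_nat -big_split /=.
  by apply: eq_bigr => s _; rewrite mulN1r mulNr.
have ey : \prod_(g <= s < g + f) (- 64 * s.+1%:R ^+ 2) = ('C(g + f, f))%:R ^+ 2 * y.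
  rewrite /y [in LHS]big_split [in RHS]big_split /= mulrCA; congr (_ * _).
    by rewrite !prodr_const_nat addKn subn0.
  by rewrite !prodrXl prod_bin exprMn.
have h3 : pint p (- (3 / 8) * (harm g - harm f)).
  by apply: pintM => //; apply: pintN => //; apply: pintM => //; exact: pint_nat.
have h1 : pint p (- 8^-1 * (harm g - harm f)) by apply: pintM => //; apply: pintN.
have hden_cong : rat_congr_pow p 2 (hden p f g)
  (y * x * (1 + p%:R * (0 + - 8^-1 * (harm g - harm f)))).
  apply: cong_mul_1p => //; [exact: pintu uy|exact: pintu ux|exact: pint0| |exact: prod1_cong].
  exact: prod0_cong.
rewrite add0r in hden_cong.
have hnum_cong : rat_congr_pow p 2 (hnum p f g (g + f))
  (((-1) ^+ (g - f) * x) * (('C(g + f, f))%:R ^+ 2 * y) * (1 + p%:R * (- (3 / 8) * (harm g -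
    harm f) - (harm (g + f) - harm g)))).
  rewrite -ex -ey; apply: cong_mul_1p => //; [| |exact: pintN|exact: prod3_cong|exact:
    prod2_cong].
    by rewrite ex; apply: pintM => //; [apply: pintX => //;
      exact: (pint_int pp (-1)) | exact: pintu ux].
  by rewrite ey; apply: pintM => //; [apply: pintX => //; exact: pint_nat | exact: pintu uy].
have uD : punit p (hden p f g).
  by apply: (punit_cong pp hden_cong); apply: punitM => //; [apply: punitM | apply: punit_1p].
apply: (congIr pp uD); rewrite eT; apply: (cong_trans pp hnum_cong); apply: (cong_sym pp).
set c := (-1) ^+ (g - f) * _.
have hc : pint p c.
  by apply: pintM => //; apply: pintX => //; [exact: (pint_int pp (-1)) | exact: pint_nat].
have -> : (-1) ^+ (g - f) * x * ('C(g + f, f)%:R ^+ 2 * y) = c * (y * x) by rewrite /c; ring.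
have -> : - (3 / 8) * (harm g - harm f) - (harm (g + f) - harm g) =
  hcorr f g + - 8^-1 * (harm g - harm f).
  by rewrite /hcorr; move: (harm g) (harm f) (harm (g + f)) => a b d; field.
apply: cong_mul_1p => //; [|exact: pint_hcorr|exact: cong_refl].
by apply: pintM => //; exact: pintu.
Qed.
End ClosedFormCong.

(** * Reduction to a hypergeometric sum *)

Lemma central_binS k : (('C(2 * k.+1, k.+1) * k.+1) = 2 * (2 * k).+1 * 'C(2 * k, k))%N.
Proof.
have e1 := mul_bin_diag (2 * k).+2 k; have e2 := mul_bin_down (2 * k).+1 k.
have h : ((2 * k).+1 - k = k.+1)%N by lia.
rewrite h /= in e1 e2 *; have -> : (2 * k.+1 = (2 * k).+2)%N by lia.
move: ('C((2 * k).+2, k.+1)) ('C((2 * k).+1, k)) ('C(2 * k, k)) e1 e2 => a b c e1 e2.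
by nia.
Qed.

Definition bin_cube_term (k : nat) : rat := ('C(2 * k, k) ^ 3)%:R / (-64) ^+ k.

Lemma bin_cube_termS k : bin_cube_term k.+1 =
  bin_cube_term k * (- (2 * k%:R + 1) ^+ 3 / (8 * (k%:R + 1) ^+ 3)).
Proof.
have k0 : 0 <= k%:R :> rat by [].
have e : ('C(2 * k.+1, k.+1))%:R = 2 * (2 * k%:R + 1) * ('C(2 * k, k))%:R / (k%:R + 1) :> rat.
  have h : k%:R + 1 != 0 :> rat by nz.
  apply: (mulIf h); rewrite mulfVK //.
  have /(congr1 (fun m => m%:R : rat)) := central_binS k.
  by rewrite !natrM -[(2 * k).+1%:R]natr1 natrM -[k.+1%:R]natr1.
rewrite /bin_cube_term !natrX e [(-64) ^+ _.+1]exprS.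
have h64 : (-64) ^+ k != 0 :> rat by rewrite expf_neq0.
move: ((-64) ^+ k) (k%:R) (('C(2 * k, k))%:R) k0 h64 => A K C k0 h64.
by field; nz.
Qed.

Section HypergeometricSum.
Variables (p n : nat).
Hypotheses (pp : prime p) (ep : p = (2 * n + 1)%N).
Let pintu u : punit p u -> pint p u. Proof. exact: punit_pint. Qed.
Let epR : p%:R = 2 * n%:R + 1 :> rat. Proof. by rewrite ep natrD natrM. Qed.
Let hp : pint p p%:R. Proof. exact: pint_nat. Qed.

Let u2 : punit p 2.
Proof. by apply: punit_nat => //; rewrite gtnNdvd //; have := prime_gt1 pp; lia. Qed.

Lemma trat_cong j : (j < n)%N -> pint p (trat p%:R j) /\
  rat_congr_pow p 2 (- (2 * j%:R + 1) ^+ 3 / (8 * (j%:R + 1) ^+ 3)) (trat p%:R j).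
Proof.
move=> lt.
have uj : punit p (j%:R + 1) by rewrite natr1; apply: punit_lt => //; lia.
have ud : punit p (4 * (j%:R + 1) ^+ 2 - p%:R ^+ 2).
  apply: (@punit_cong _ pp 1 _ ((2 * (j%:R + 1)) ^+ 2)).
    apply/congP; exists (- 1); first exact: (pint_int pp (-1)).
    by rewrite natrX; move: (p%:R) (j%:R) => P J; ring.
  by apply: punitX => //; apply: punitM.
have hj : pint p (2 * j%:R + 1) by rewrite -natrM natr1; apply: pint_nat.
split.
  apply: pintM => //; last first.
    by apply: pintu; apply: punitV; apply: punitM => //; apply: punitM.
  by apply: pintM => //; apply: pintB => //; apply: pintX.
apply: cong_sym => //; apply/congP.
(* The quotient of [trat p j - trat 0 j] by [p ^ 2]; it is integral at [p] because [trat] is even in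
   [P]. *)
exists ((2 * j%:R + 1) * (4 * (j%:R + 1) ^+ 2 - (2 * j%:R + 1) ^+ 2) / ((2 * (j%:R + 1)) ^+ 3 *
  (4 * (j%:R + 1) ^+ 2 - p%:R ^+ 2))).
  apply: pintM => //; last first.
    by apply: pintu; apply: punitV; apply: punitM => //; apply: punitX => //; apply: punitM.
  apply: pintM => //; apply: pintB => //; last exact: pintX.
  by apply: pintM => //; [exact: pint_nat | apply: pintX => //; exact: pintu].
have [+ _] := uj; have [+ _] := ud.
rewrite natrX /trat; move: (p%:R) (j%:R) => P J h1 h2; field; nz.
Qed.

Lemma hterm_cong k : (k <= n)%N -> pint p (hterm n k) /\ rat_congr_pow p 2 (bin_cube_term k)
  (hterm n k).
Proof.
elim: k => [|k IH] lt.
  rewrite hterm0 /bin_cube_term bin0 expr0 divr1; split; [exact: pint1 | exact: cong_refl].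
have [h1 h2] := IH (ltnW lt); have [h3 h4] := trat_cong lt.
rewrite bin_cube_termS /hterm big_ord_recr /= -epR -/(hterm n k).
have -> : \prod_(i < k) trat p%:R i = hterm n k by rewrite /hterm epR.
split; first exact: pintM.
apply: congM => //.
have -> : - (2 * k%:R + 1) ^+ 3 / (8 * (k%:R + 1) ^+ 3) =
  (- (2 * k%:R + 1) ^+ 3 / (8 * (k%:R + 1) ^+ 3) - trat p%:R k) + trat p%:R k by rewrite subrK.
case/congP: h4 => u hu ->; apply: pintD => //; apply: pintM => //; exact: pint_nat.
Qed.

Lemma pint_hmoment (w : nat -> rat) :
  (forall k, (k <= n)%N -> pint p (w k)) -> pint p (hmoment n w).
Proof.
move=> hw; apply: pint_sum => // k _; have hk : (k <= n)%N by rewrite -ltnS.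
by apply: pintM => //; [exact: hw | case: (hterm_cong hk)].
Qed.

Lemma sum_inv_cong : punit p (hmoment n (fun=> 1)) ->
  rat_congr_pow p 2 (\sum_(0 <= k < n + 1) ('C(2 * k, k) ^ 3)%:R / ((-64) ^+ k * (k + 1)%:R))
    (3 / 2 * hmoment n (fun=> 1) - (-1) ^+ n * p%:R).
Proof.
move=> uT.
have hinv k : (k <= n)%N -> pint p (k%:R + 1)^-1.
  move=> hk; apply: pintu; apply: punitV; rewrite natr1; apply: punit_lt => //.
  by have := prime_gt1 pp; lia.
pose V := hmoment n (fun k => (k%:R + 1)^-1).
have hV : pint p V by exact: pint_hmoment.
apply: (@cong_trans _ pp _ V).
  rewrite addn1 big_mkord; apply: cong_sum => // k _.
  have hk : (k <= n)%N by rewrite -ltnS.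
  have [_ h] := hterm_cong hk.
  have -> : ('C(2 * k, k) ^ 3)%:R / ((-64) ^+ k * (k + 1)%:R) =
    (k%:R + 1)^-1 * bin_cube_term k :> rat.
    by rewrite /bin_cube_term addn1 -[k.+1%:R]natr1 invfM; ring.
  exact: (congMl pp (hinv k hk) h).
set T := hmoment n _ in uT *.
have [T0 [hT hTi]] := uT.
pose M1 := hmoment n (fun k => k%:R). pose M2 := hmoment n (fun k => k%:R ^+ 2).
have e1 : 4 * M1 + T = (-1) ^+ n * p%:R.
  rewrite epR -moment_linear /M1 /T /hmoment mulr_sumr -big_split /=.
  by apply: eq_bigr => k _; ring.
have e2 : ((16 * n%:R ^+ 2 + 16 * n%:R + 1) * T - 16 * M1 - 32 * M2) * T = p%:R ^+ 2.
  rewrite epR -moment_quadratic_mul; congr (_ * _).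
  rewrite /M1 /T /M2 /hmoment !mulr_sumr -!sumrB.
  by apply: eq_bigr => k _; ring.
have e3 := moment_inv n; rewrite -/T -/M1 -/M2 -/V in e3.
(* Eliminating [M1] and [M2] from [e1], [e2] and [e3], with [n (n + 1) = (p ^ 2 - 1) / 4], leaves
   exactly [p ^ 2] times this. The term [T^-1] comes from [e2] and is why [T] has to be a unit. *)
apply/congP; exists (V - 2 * T + 2 - 2^-1 * T^-1).
  have h2 : pint p 2 by exact: pintu.
  have h2i : pint p 2^-1 by apply: pintu; apply: punitV.
  apply: pintB => //; last exact: pintM.
  by apply: pintD => //; apply: pintB => //; apply: pintM.
rewrite natrX.
have eQ : (16 * n%:R ^+ 2 + 16 * n%:R + 1) * T - 16 * M1 - 32 * M2 = p%:R ^+ 2 * T^-1.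
  by apply: (mulIf T0); rewrite e2 divfK.
have -> : p%:R ^+ 2 * (V - 2 * T + 2 - 2^-1 * T^-1) =
  p%:R ^+ 2 * (V - 2 * T + 2) - 2^-1 * (p%:R ^+ 2 * T^-1) by ring.
rewrite -eQ; have -> : (-1) ^+ n * p%:R = 4 * M1 + T by rewrite e1.
rewrite epR; clear uT T0 hT hTi e1 e2 eQ hV; move: (n%:R) V M1 M2 T e3 => N V' M1' M2' T' e3.
lra.
Qed.
End HypergeometricSum.

(** * Jacobi sums over a finite field *)

Section Jacobi.
Variables (F : finFieldType) (R : comNzRingType).

Definition mulchar (a : F -> R) :=
  [/\ a 0 = 0, a 1 = 1 & forall x y, a (x * y) = a x * a y].

Definition jacobi (a b : F -> R) : R := \sum_x a x * b (1 - x).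

Lemma jacobiC a b : jacobi a b = jacobi b a.
Proof.
have inj : injective (fun x : F => 1 - x) by move=> x y /addrI /oppr_inj.
rewrite /jacobi (reindex_inj inj) /=; apply: eq_bigr => x _.
by rewrite subKr mulrC.
Qed.

(* Both sides are [\sum_(x + y + z = 1) a x * b y * c z]; since [b * c] is
   trivial, the inner sum over [y + z = 1 - x] only depends on whether [x = 1]. *)
Lemma jacobi_triple a b c : mulchar a -> mulchar b -> mulchar c ->
  (forall x, x != 0 -> b x * c x = 1) ->
  \sum_x a x = 0 -> \sum_x b x = 0 -> \sum_x a x * b x = 0 ->
  jacobi a b * jacobi (fun x => a x * b x) c = #|F|%:R * b (-1).
Proof.
move=> [a0 a1 aM] [b0 b1 bM] [c0 c1 cM] bc sa sb sab.
have step s : (a s * b s * c (1 - s)) * jacobi a b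
    = \sum_x a x * (b (s - x) * c (1 - s)).
  have [->|s0] := eqVneq s 0.
    rewrite a0 !mul0r subr0 c1; under eq_bigr => x _ do rewrite sub0r mulr1 -mulN1r bM mulrCA.
    by rewrite -mulr_sumr sab mulr0.
  have inj : injective (fun x : F => s * x) by move=> x y /(mulfI s0).
  rewrite [RHS](reindex_inj inj) /jacobi mulr_sumr; apply: eq_bigr => x _ /=.
  have -> : s - s * x = s * (1 - x) by rewrite mulrBr mulr1.
  by rewrite aM bM; ring.
have inner x : \sum_s b (s - x) * c (1 - s) = b (-1) * (#|F|%:R * (x == 1)%:R - 1).
  rewrite (bigD1 1) //= subrr c0 mulr0 add0r.
  have e s : s != 1 -> b (s - x) * c (1 - s) = b ((s - x) / (1 - s)).
    move=> s1; have h : 1 - s != 0 by rewrite subr_eq0 eq_sym.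
    by rewrite -{1}[s - x](divfK h) bM -mulrA bc ?mulr1.
  rewrite (eq_bigr _ e).
  have [->|x1] := eqVneq x 1.
    rewrite mulr1 (eq_bigr (fun=> b (-1))) => [|s s1]; last first.
      by rewrite -opprB mulNr divff // subr_eq0 eq_sym.
    rewrite sumr_const cardC1 -[LHS]mulr_natr; congr (_ * _).
    by rewrite -subn1 natrB //; apply/card_gt0P; exists 0.
  rewrite mulr0 sub0r mulrN1.
  apply/eqP; rewrite -addr_eq0 addrC; apply/eqP.
  rewrite -[RHS]sb [RHS](bigD1 (-1)) //=; congr (_ + _).
  (* For [x != 1] this homography maps the field without [1] bijectively onto the field without
     [-1], so the inner sum is the full sum of [b], which is 0, less [b (-1)]. *)
  pose h (s : F) := (s - x) / (1 - s); pose h' (t : F) := (t + x) / (1 + t).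
  rewrite [RHS](reindex_onto h h') /=; last first.
    move=> t t1; have t1' : 1 + t != 0 by rewrite addrC -[1]opprK subr_eq0.
    have x1' : 1 - x != 0 by rewrite subr_eq0 eq_sym.
    rewrite /h /h'; have -> : 1 - (t + x) / (1 + t) = (1 - x) / (1 + t) by field.
    have -> : (t + x) / (1 + t) - x = t * (1 - x) / (1 + t) by field.
    by field; rewrite t1' x1'.
  apply: eq_bigl => s; apply/idP/andP => [s1|[s1 /eqP <-]].
    have h1 : 1 - s != 0 by rewrite subr_eq0 eq_sym.
    have x1' : 1 - x != 0 by rewrite subr_eq0 eq_sym.
    have h2 : h s != -1.
      apply/eqP => /(congr1 (fun u => u * (1 - s))).
      rewrite /h divfK // mulN1r opprB => /(congr1 (fun u => u - s)).
      by rewrite addrAC subrr sub0r addrAC subrr sub0r => /oppr_inj e1; rewrite e1 eqxx in x1.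
    split=> //; rewrite /h /h'; apply/eqP.
    have -> : 1 + (s - x) / (1 - s) = (1 - x) / (1 - s) by field.
    have -> : (s - x) / (1 - s) + x = s * (1 - x) / (1 - s) by field.
    by field; rewrite h1 x1'.
  apply/negP => /eqP e1; have : h' (h s) * (1 + h s) = h s + x.
    by rewrite /h' divfK // addrC -[1]opprK subr_eq0.
  rewrite e1 mul1r addrC => /addrI /eqP; by rewrite eq_sym (negPf x1).
rewrite mulrC /jacobi mulr_suml (eq_bigr _ (fun s _ => step s)) exchange_big /=.
under eq_bigr => x _ do rewrite -mulr_sumr inner mulrCA mulrBr mulr1.
rewrite -mulr_sumr sumrB sa subr0 (bigD1 1) //= a1 mul1r eqxx mulr1.
rewrite big1 ?addr0 1?mulrC // => x x1.
by rewrite (negPf x1) mulr0 mulr0.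
Qed.

(** Substitute [x^-1] for [x]: [1 - x^-1 = - x^-1 (1 - x)], and [a b] at [x^-1] equals [c] at
    [x]. *)
Lemma jacobi_inv a b c : mulchar a -> mulchar b -> mulchar c ->
  (forall x, x != 0 -> a x * b x * c x = 1) ->
  jacobi a b = b (-1) * jacobi c b.
Proof.
move=> [a0 a1 aM] [b0 b1 bM] [c0 c1 cM] abc.
rewrite /jacobi mulr_sumr (bigD1 0) //= a0 mul0r add0r [RHS](bigD1 0) //= c0 mul0r mulr0 add0r.
rewrite (reindex_inj invr_inj) /=; apply: eq_big => x; first by rewrite invr_eq0.
rewrite invr_eq0 => x0.
have xi : x^-1 != 0 by rewrite invr_eq0.
have -> : 1 - x^-1 = x^-1 * ((-1) * (1 - x)) by field.
rewrite !bM mulrA mulrCA; congr (_ * _).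
have := abc _ xi => e.
have ec : c x * c x^-1 = 1 by rewrite -cM divff.
have -> : a x^-1 * b x^-1 = c x by rewrite -[LHS]mulr1 -ec mulrCA e mulr1.
by [].
Qed.
End Jacobi.

(** * Characters defined by a discrete logarithm *)

Lemma finField_prim_root (F : finFieldType) : exists g : F, (#|F|.-1).-primitive_root g.
Proof.
have q1 : (0 < #|F|.-1)%N by have := finNzRing_gt1 F; case: #|F| => [|[]].
have : has (#|F|.-1).-primitive_root [seq x <- enum F | x != 0].
  apply: has_prim_root => //.
  - apply/allP => x; rewrite mem_filter => /andP[x0 _].
    rewrite unity_rootE; apply/eqP; apply: (mulfI x0).
    by rewrite -exprS mulr1 prednK ?expf_card // ltnW // finNzRing_gt1.
  - by rewrite filter_uniq // enum_uniq.
  rewrite -(cardC1 (0 : F)) cardE; apply: uniq_leq_size; first exact: enum_uniq.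
  by move=> x; rewrite mem_enum !inE mem_filter mem_enum => ->.
by case/hasP=> g _ hg; exists g.
Qed.

Section Char.
Variables (F : finFieldType) (g : F).
Local Notation q := #|F|.
Hypothesis hg : (q.-1).-primitive_root g.

Definition dlog (x : F) : nat := index x (mkseq (fun i => g ^+ i) q.-1).

(** The target ring is arbitrary because the same Jacobi sum is evaluated both in [algC] and in a
    ring of characteristic [p ^ 2]. Even for [z = 1] the value at 0 is 0. *)
Definition chi (R : comNzRingType) (z : R) (x : F) : R := if x == 0 then 0 else z ^+ dlog x.

Lemma gexp_neq0 i : g ^+ i != 0.
Proof.
rewrite expf_neq0 //; apply/eqP => g0; have := prim_expr_order hg.
by rewrite g0 expr0n; case: (q.-1) (prim_order_gt0 hg) => // n _ /eqP; rewrite eq_sym oner_eq0.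
Qed.

Lemma gexp_inj i j : (i < q.-1)%N -> (j < q.-1)%N -> g ^+ i = g ^+ j -> i = j.
Proof. by move=> hi hj /eqP; rewrite (eq_prim_root_expr hg) !modn_small // => /eqP. Qed.

Lemma gexp_uniq : uniq (mkseq (fun i => g ^+ i) q.-1).
Proof. by apply/mkseq_uniqP => i j hi hj; apply: gexp_inj. Qed.

Lemma mem_gexp x : x != 0 -> x \in mkseq (fun i => g ^+ i) q.-1.
Proof.
move=> x0; have [||_ h] := uniq_min_size gexp_uniq (s2 := [seq x <- enum F | x != 0]).
  - by move=> y /mapP[i _ ->]; rewrite mem_filter mem_enum gexp_neq0.
  - rewrite size_mkseq -(cardC1 (0 : F)) cardE; apply: uniq_leq_size.
    by rewrite filter_uniq // enum_uniq.
  by move=> y; rewrite mem_filter mem_enum mem_enum => /andP[].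
by rewrite h mem_filter x0 mem_enum.
Qed.

Lemma dlog_lt x : x != 0 -> (dlog x < q.-1)%N.
Proof. by move=> x0; have := mem_gexp x0; rewrite -index_mem size_mkseq. Qed.

Lemma dlogK x : x != 0 -> g ^+ dlog x = x.
Proof.
move=> x0; have := nth_index 0 (mem_gexp x0).
by rewrite nth_mkseq // dlog_lt.
Qed.

Lemma chi_mulchar (R : comNzRingType) (z : R) : z ^+ q.-1 = 1 -> mulchar (chi z).
Proof.
move=> hz; have e x y i j : x != 0 -> y != 0 -> g ^+ i = x -> g ^+ j = y -> x = y -> z ^+ i =
  z ^+ j.
  move=> _ _ <- <- /eqP; rewrite (eq_prim_root_expr hg) => /eqP h.
  by rewrite -(expr_mod i hz) h expr_mod.
split; first by rewrite /chi eqxx.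
  have n0 : 1 != 0 :> F := oner_neq0 _.
  rewrite /chi (negPf n0) -[RHS](expr0 z).
  exact: (e 1 1 _ _ n0 n0 (dlogK n0) (expr0 g)).
move=> x y; rewrite /chi mulf_eq0.
have [->|x0] := eqVneq x 0; first by rewrite /= mul0r.
have [->|y0] := eqVneq y 0; first by rewrite /= mulr0.
have xy0 : x * y != 0 by rewrite mulf_neq0.
rewrite -exprD; apply: (e (x * y) (x * y)) => //; first exact: dlogK.
by rewrite exprD !dlogK.
Qed.

Lemma chi_gexp (R : comNzRingType) (z : R) i : z ^+ q.-1 = 1 -> chi z (g ^+ i) = z ^+ i.
Proof.
move=> hz; rewrite /chi (negPf (gexp_neq0 i)).
have /eqP := dlogK (gexp_neq0 i); rewrite (eq_prim_root_expr hg) => /eqP h.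
by rewrite -(expr_mod (dlog _) hz) h expr_mod.
Qed.

Lemma sum_gexp (R : nmodType) (f : F -> R) : \sum_(x | x != 0) f x = \sum_(i < q.-1) f (g ^+ i).
Proof.
rewrite -(big_mkord xpredT (fun i => f (g ^+ i))) /index_iota subn0.
rewrite -[RHS](big_map (fun i => g ^+ i) xpredT f) -[LHS]big_filter.
apply: perm_big; apply: uniq_perm; first by rewrite filter_uniq // index_enum_uniq.
  exact: gexp_uniq.
move=> x; rewrite mem_filter mem_index_enum andbT; apply/idP/idP; first exact: mem_gexp.
by case/mapP=> i _ ->; rewrite gexp_neq0.
Qed.

Lemma sum_chi_mul (R : comNzRingType) (z : R) (f : F -> R) : z ^+ q.-1 = 1 ->
  \sum_x chi z x * f x = \sum_(i < q.-1) z ^+ i * f (g ^+ i).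
Proof.
move=> hz; rewrite (bigD1 0) //= {1}/chi eqxx mul0r add0r sum_gexp.
by apply: eq_bigr => i _; rewrite chi_gexp.
Qed.

Lemma sum_chi (R : idomainType) (z : R) : z ^+ q.-1 = 1 -> z != 1 -> \sum_x chi z x = 0.
Proof.
move=> hz z1; under eq_bigr => x _ do rewrite -[chi _ _]mulr1.
rewrite sum_chi_mul //; under eq_bigr => x _ do rewrite mulr1.
apply/eqP; have /eqP := subrX1 z q.-1; rewrite hz subrr eq_sym mulf_eq0.
by rewrite subr_eq0 (negPf z1).
Qed.

Lemma chiM (R : comNzRingType) (u v : R) x : chi u x * chi v x = chi (u * v) x.
Proof. by rewrite /chi; case: eqP => _; rewrite ?mulr0 // exprMn. Qed.

Lemma chi1 (R : comNzRingType) x : x != 0 -> chi (1 : R) x = 1.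
Proof. by move=> x0; rewrite /chi (negPf x0) expr1n. Qed.
End Char.

(** The integers are the coefficients of the remainder of [P] by [X ^ 4 + 1]. They are chosen before
    the ring, so that what is proved about them in [algC] holds in every ring. *)
Lemma reduce_zeta8 (P : {poly int}) : exists d0 d1 d2 d3 : int,
  forall (R : comNzRingType) (z : R), z ^+ 4 = -1 ->
  (map_poly intr P).[z] = d0%:~R + d1%:~R * z + d2%:~R * z ^+ 2 + d3%:~R * z ^+ 3.
Proof.
elim/poly_ind: P => [|P c [d0 [d1 [d2 [d3 h]]]]].
  exists 0, 0, 0, 0 => R z _; rewrite rmorph0 horner0; ring.
exists (c - d3), d0, d1, d2 => R z hz.
rewrite rmorphD rmorphM /= map_polyX map_polyC /= !hornerE h // rmorphB /=.
have -> : (d0%:~R + d1%:~R * z + d2%:~R * z ^+ 2 + d3%:~R * z ^+ 3) * z =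
  d0%:~R * z + d1%:~R * z ^+ 2 + d2%:~R * z ^+ 3 + d3%:~R * z ^+ 4 by ring.
by rewrite hz; ring.
Qed.

Lemma zeta8_free (z : algC) (d0 d1 d2 d3 : int) : 8.-primitive_root z ->
  d0%:~R + d1%:~R * z + d2%:~R * z ^+ 2 + d3%:~R * z ^+ 3 = 0 ->
  [/\ d0 = 0, d1 = 0, d2 = 0 & d3 = 0].
Proof.
move=> hz e; have [p [mp pm] hp] := minCpolyP z.
pose s : seq rat := [:: d0%:~R; d1%:~R; d2%:~R; d3%:~R].
have : root (map_poly ratr (Poly s)) z.
  rewrite rootE -e /s /= !cons_poly_def !rmorphD !rmorphM /= !rmorphD !rmorphM /= !rmorphD
    !rmorphM /= !map_polyC !map_polyX /= !hornerE.
  by rewrite ?map_polyC /= ?hornerC !ratr_int; apply/eqP; ring.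
rewrite hp => hd; have sp : size p = 5%N.
  by have := congr1 (fun r : {poly algC} => size r) mp;
    rewrite size_map_poly (minCpoly_cyclotomic hz) size_cyclotomic.
have Ps0 : Poly s = 0.
  apply/eqP; apply: contraTT hd => n0; rewrite gtNdvdp // sp ltnS.
  exact: size_Poly.
have c i : s`_i = 0 by rewrite -coef_Poly Ps0 coef0.
by have /eqP := c 0%N; have /eqP := c 1%N; have /eqP := c 2%N; have /eqP := c 3%N;
  rewrite /= !intr_eq0 => /eqP ? /eqP ? /eqP ? /eqP ?.
Qed.

Section Evaluation.
Variables (F : finFieldType) (g : F).
Local Notation q := #|F|.
Hypotheses (hg : (q.-1).-primitive_root g) (q8 : (8 %| q.-1)%N).

Definition qchi (R : comNzRingType) : F -> R := chi g (-1).

Definition oct_sum (R : comNzRingType) (z : R) : R := jacobi (chi g z) (qchi R).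

Lemma qchi_int (R : comNzRingType) x : qchi R x = (qchi int x)%:~R.
Proof. by rewrite /qchi /chi; case: eqP => // _; rewrite rmorphXn rmorphN1. Qed.

Lemma expr8 (R : comNzRingType) (z : R) : z ^+ 4 = -1 -> z ^+ q.-1 = 1.
Proof. by case/dvdnP: q8 => k ->; rewrite mulnC (exprM z 8) (exprM z 4 2) => ->;
  rewrite sqrrN expr1n expr1n. Qed.

Lemma exprN1q (R : comNzRingType) : (-1) ^+ q.-1 = 1 :> R.
Proof. by case/dvdnP: q8 => k ->; rewrite mulnC (exprM _ 8) (exprM _ 2 4) sqrrN !expr1n. Qed.

Lemma oct_sumE (R : comNzRingType) (z : R) : z ^+ 4 = -1 ->
  oct_sum z = \sum_(i < q.-1) z ^+ i * qchi R (1 - g ^+ i).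
Proof. by move=> hz; rewrite /oct_sum /jacobi sum_chi_mul // expr8. Qed.

Lemma chi_opp1_sqr (R : comNzRingType) (z : R) : z ^+ q.-1 = 1 -> chi g z (-1) ^+ 2 = 1.
Proof. by move=> hz; case: (chi_mulchar hg hz) => _ h1 hM; rewrite expr2 -hM mulrNN mulr1. Qed.

Lemma zeta8_neq1 (z : algC) : z ^+ 4 = -1 -> z != 1.
Proof.
move=> z4; apply/eqP => z1; move: z4; rewrite z1 expr1n => /eqP.
by rewrite -subr_eq0 opprK -mulr2n pnatr_eq0.
Qed.

Lemma oct_sum_triple (z : algC) : z ^+ 4 = -1 ->
  oct_sum z * jacobi (chi g (z ^+ 5)) (chi g (z ^+ 7)) = q%:R * chi g z (-1).
Proof.
move=> z4; have z8 : z ^+ 8 = 1 by rewrite (exprM z 4 2) z4 sqrrN expr1n.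
have z5 : z ^+ 5 = -1 * z by rewrite (exprD z 4 1) z4.
have hz k : (z ^+ k) ^+ q.-1 = 1 by rewrite exprAC expr8 // expr1n.
have n11 : (-1 : algC) != 1 by rewrite -subr_eq0 -opprD oppr_eq0 -mulr2n pnatr_eq0.
have nz : z != 1 := zeta8_neq1 z4.
have nz5 : -1 * z != 1.
  apply: contraTneq isT => h; have := zeta8_neq1 (z := -1 * z).
  by rewrite mulN1r exprNn -signr_odd mul1r => /(_ z4); rewrite -mulN1r h eqxx.
have ejac : jacobi (chi g (z ^+ 5)) (chi g (z ^+ 7)) =
  jacobi (fun x => qchi algC x * chi g z x) (chi g (z ^+ 7)).
  by apply: eq_bigr => x _; rewrite /qchi chiM z5.
rewrite ejac /oct_sum jacobiC; apply: jacobi_triple.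
- by apply: chi_mulchar => //; exact: exprN1q.
- by apply: chi_mulchar => //; exact: expr8.
- exact: chi_mulchar.
- by move=> x x0; rewrite chiM -exprS z8 chi1.
- by apply: sum_chi => //; exact: exprN1q.
- by apply: sum_chi => //; exact: expr8.
under eq_bigr => x _ do rewrite /qchi chiM -z5.
by apply: sum_chi; rewrite // z5.
Qed.

(* [chi ^ 3] exchanges [chi ^ 5] and [chi ^ 7], so [oct_sum_triple] has the same cofactor
   for [z] and [z ^ 3]. *)
Lemma oct_sum_exp3 (z : algC) : z ^+ 4 = -1 -> oct_sum z = oct_sum (z ^+ 3).
Proof.
move=> z4; have z8 : z ^+ 8 = 1 by rewrite (exprM z 4 2) z4 sqrrN expr1n.
have e1 := oct_sum_triple z4; have z34 : (z ^+ 3) ^+ 4 = -1 by rewrite exprAC z4 -signr_odd.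
have e2 := oct_sum_triple z34.
have e5 : (z ^+ 3) ^+ 5 = z ^+ 7 by rewrite -exprM (exprD z 8 7) z8 mul1r.
have e7 : (z ^+ 3) ^+ 7 = z ^+ 5 by rewrite -exprM (exprD z 16 5) (exprM z 8 2) z8 expr1n mul1r.
have ec : chi g (z ^+ 3) (-1) = chi g z (-1).
  rewrite -[RHS]mul1r -(chi_opp1_sqr (expr8 z4)) -exprSr.
  by rewrite /chi; case: eqP => _; rewrite ?expr0n // exprAC.
rewrite e5 e7 ec jacobiC -e1 in e2.
have h0 : oct_sum z * jacobi (chi g (z ^+ 5)) (chi g (z ^+ 7)) != 0.
  rewrite e1 mulf_neq0 //; first by rewrite pnatr_eq0 -lt0n ltnW // finNzRing_gt1.
  by apply/eqP => h; have := chi_opp1_sqr (expr8 z4); rewrite h expr0n => /eqP;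
    rewrite eq_sym oner_eq0.
move: h0; rewrite mulf_eq0 negb_or => /andP[_ h0].
by apply: (mulIf h0).
Qed.

(** Here [oct_sum (z ^+ 7)] plays the part of the complex conjugate. The cofactor of
    [oct_sum_triple] becomes it under [jacobi_inv], since the product of [chi ^ 5], [chi ^ 7] and
    the quadratic character is trivial. *)
Lemma oct_sum_norm (z : algC) : z ^+ 4 = -1 -> oct_sum z * oct_sum (z ^+ 7) = q%:R.
Proof.
move=> z4; have z8 : z ^+ 8 = 1 by rewrite (exprM z 4 2) z4 sqrrN expr1n.
have hz k : (z ^+ k) ^+ q.-1 = 1 by rewrite exprAC expr8 // expr1n.
have := oct_sum_triple z4.
rewrite (jacobi_inv (c := qchi algC)) //; first last.
- move=> x x0; rewrite /qchi !chiM -exprD (_ : z ^+ (5 + 7) * -1 = 1) ?chi1 //.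
  by rewrite (exprD z 8 4) z8 z4 mul1r mulrNN mulr1.
- by apply: chi_mulchar => //; exact: exprN1q.
- exact: chi_mulchar.
- exact: chi_mulchar.
have h2 := chi_opp1_sqr (expr8 z4).
have -> : chi g (z ^+ 7) (-1) = chi g z (-1).
  have -> : chi g (z ^+ 7) (-1) = chi g z (-1) ^+ 7.
    by rewrite /chi; case: eqP => _; rewrite ?expr0n // exprAC.
  by rewrite (exprD _ 6 1) (exprM _ 2 3) h2 expr1n mul1r expr1.
rewrite jacobiC -/(oct_sum (z ^+ 7)) mulrCA => e.
by rewrite -[LHS]mul1r -[X in X * _]h2 expr2 -mulrA e mulrCA -expr2 h2 mulr1.
Qed.

(** Invariance under [z -> z ^ 3] confines the sum to the subring generated by [z + z ^ 3], whose
    square is [-2]. *)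
Lemma oct_sum_coef : exists a b : int, forall (R : comNzRingType) (z : R), z ^+ 4 = -1 ->
  oct_sum z = a%:~R + b%:~R * (z + z ^+ 3).
Proof.
have [d0 [d1 [d2 [d3 hd]]]] := reduce_zeta8 (\sum_(i < q.-1) qchi int (1 - g ^+ i) *: 'X^i).
have {}hd (R : comNzRingType) (z : R) : z ^+ 4 = -1 -> oct_sum z =
  d0%:~R + d1%:~R * z + d2%:~R * z ^+ 2 + d3%:~R * z ^+ 3.
  move=> hz; rewrite -hd // oct_sumE // rmorph_sum /= horner_sum; apply: eq_bigr => i _.
  by rewrite map_polyZ map_polyXn /= hornerZ hornerXn mulrC qchi_int.
have [z hz] := C_prim_root_exists (n := 8) isT.
have z4 : z ^+ 4 = -1.
  have /eqP : (z ^+ 4) ^+ 2 = 1 by rewrite -exprM (prim_expr_order hz).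
  rewrite sqrf_eq1 => /orP[/eqP h|/eqP //].
  by have := prim_order_dvd hz 4; rewrite h eqxx.
have z34 : (z ^+ 3) ^+ 4 = -1 by rewrite exprAC z4 -signr_odd.
have := oct_sum_exp3 z4; rewrite (hd _ _ z4) (hd _ _ z34) => /eqP.
rewrite -subr_eq0 => /eqP e.
have : 0%:~R + (d1 - d3)%:~R * z + (2 * d2)%:~R * z ^+ 2 + (d3 - d1)%:~R * z ^+ 3 = 0.
  rewrite -[RHS]e !rmorphB rmorphM /=.
  have -> : (z ^+ 3) ^+ 2 = z ^+ 4 * z ^+ 2 by ring.
  have -> : (z ^+ 3) ^+ 3 = (z ^+ 4) ^+ 2 * z by ring.
  rewrite z4; ring.
case/(zeta8_free hz) => _ h1 h2 _.
exists d0, d1 => R y hy; rewrite hd //.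
have -> : d3 = d1 by lia.
have -> : d2 = 0 by lia.
by ring.
Qed.

(* [a = - q] modulo 4 comes from [(qchi (1 - t) - 1) * (chi t - 1)], which is divisible by
   [2 (1 - z)]; the sum over [t] is [oct_sum z + q]. *)
Lemma oct_sum_representation : exists a b : int,
  [/\ forall (R : comNzRingType) (z : R), z ^+ 4 = -1 -> oct_sum z = a%:~R + b%:~R * (z + z ^+ 3),
      a ^+ 2 + 2 * b ^+ 2 = q%:Z & (4 %| a + q%:Z)%Z].
Proof.
have [a [b hab]] := oct_sum_coef.
have [z hz] := C_prim_root_exists (n := 8) isT.
have z4 : z ^+ 4 = -1.
  have /eqP : (z ^+ 4) ^+ 2 = 1 by rewrite -exprM (prim_expr_order hz).
  rewrite sqrf_eq1 => /orP[/eqP h|/eqP //].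
  by have := prim_order_dvd hz 4; rewrite h eqxx.
exists a, b; split=> //.
  have z74 : (z ^+ 7) ^+ 4 = -1 by rewrite exprAC z4 -signr_odd.
  apply: (@intr_inj algC).
  rewrite rmorphD rmorphM !rmorphXn /= -[RHS]/(q%:R) -(oct_sum_norm z4) (hab _ _ z4)
    (hab _ _ z74).
  have -> : z ^+ 7 = - z ^+ 3 by have -> : z ^+ 7 = z ^+ 4 * z ^+ 3; [ring | rewrite z4; ring].
  have -> : (- z ^+ 3) ^+ 3 = - z.
    have -> : (- z ^+ 3) ^+ 3 = - ((z ^+ 4) ^+ 2 * z) by ring.
    rewrite z4; ring.
  have -> : (a%:~R + b%:~R * (z + z ^+ 3)) * (a%:~R + b%:~R * (- z ^+ 3 - z)) =
    a%:~R ^+ 2 - b%:~R ^+ 2 * (z ^+ 2 + 2 * z ^+ 4 + z ^+ 4 * z ^+ 2) by ring.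
  rewrite z4; ring.
pose e i : int := (qchi int (1 - g ^+ i) == -1)%:Z.
have [g0 [g1 [g2 [g3 hG]]]] := reduce_zeta8 (\sum_(1 <= i < q.-1) e i *: \sum_(k < i) 'X^k).
have := hG _ _ z4; rewrite rmorph_sum /= horner_sum => {}hG.
have q1 : (1 < q.-1)%N by case: (q.-1) (prim_order_gt0 hg) q8 => [|[]].
have key : oct_sum z + q%:R = 2 * (1 - z) *
  (g0%:~R + g1%:~R * z + g2%:~R * z ^+ 2 + g3%:~R * z ^+ 3).
  rewrite -hG mulr_sumr.
  have -> : \sum_(1 <= i < q.-1) 2 * (1 - z) * (map_poly intr (e i *: \sum_(k < i) 'X^k)).[z]
    = \sum_(1 <= i < q.-1) (qchi algC (1 - g ^+ i) - 1) * (z ^+ i - 1).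
    apply: eq_big_nat => i /andP[i1 i2].
    rewrite map_polyZ /= hornerZ rmorph_sum horner_sum /=.
    under eq_bigr => k _ do rewrite map_polyXn hornerXn.
    rewrite subrX1 /e (qchi_int algC).
    have : qchi int (1 - g ^+ i) = 1 \/ qchi int (1 - g ^+ i) = -1.
      rewrite /qchi /chi subr_eq0 eq_sym; case: ifP => [/eqP h|_].
        have := gexp_inj hg i2 (prim_order_gt0 hg); rewrite expr0 => /(_ h) i0.
        by rewrite i0 in i1.
      by rewrite -signr_odd; case: odd; [right|left].
    by case=> ->; rewrite ?eqxx /=; move: (\sum_(_ < _) _) => S; rewrite ?rmorphN ?rmorph1; ring.
  have -> : \sum_(1 <= i < q.-1) (qchi algC (1 - g ^+ i) - 1) * (z ^+ i - 1)
    = \sum_(0 <= i < q.-1) (qchi algC (1 - g ^+ i) - 1) * (z ^+ i - 1).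
    by rewrite [RHS]big_ltn ?(prim_order_gt0 hg) // !expr0 !subrr mulr0 add0r.
  rewrite big_mkord.
  have ex (i : 'I_(q.-1)) : (qchi algC (1 - g ^+ i) - 1) * (z ^+ i - 1)
     = z ^+ i * qchi algC (1 - g ^+ i) - qchi algC (1 - g ^+ i) - (z ^+ i - 1) by ring.
  rewrite (eq_bigr _ (fun i _ => ex i)) !sumrB -oct_sumE //.
  have -> : \sum_(i < q.-1) z ^+ i = 0.
    apply/eqP; have /eqP := subrX1 z q.-1; rewrite (expr8 z4) subrr eq_sym mulf_eq0.
    by rewrite subr_eq0 (negPf (zeta8_neq1 z4)).
  have -> : \sum_(i < q.-1) qchi algC (1 - g ^+ i) = -1.
    rewrite -(sum_gexp hg (fun x => qchi algC (1 - x))).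
    have n11 : (-1 : algC) != 1 by rewrite -subr_eq0 -opprD oppr_eq0 -mulr2n pnatr_eq0.
    have := sum_chi hg (exprN1q algC) n11.
    have inj : injective (fun x : F => 1 - x) by move=> x y /addrI /oppr_inj.
    rewrite (reindex_inj inj) /= (bigD1 0) //= subr0.
    case: (chi_mulchar hg (exprN1q algC)) => _ -> _ => /eqP.
    by rewrite addrC addr_eq0 => /eqP.
  rewrite sumr_const card_ord; have -> : q%:R = q.-1%:R + 1 :> algC.
    by rewrite natr1 prednK // ltnW // finNzRing_gt1.
  by ring.
have := zeta8_free (d0 := a + q%:Z - 2 * (g0 + g3)) (d1 := b - 2 * (g1 - g0))
  (d2 := - 2 * (g2 - g1))
  (d3 := b - 2 * (g3 - g2)) hz.
case.
  rewrite !rmorphB !rmorphD !rmorphM !rmorphB !rmorphD /= -[(q%:Z)%:~R]/(q%:R).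
  have := key; rewrite (hab _ _ z4) => k.
  have k2 : a%:~R + q%:R = 2 * (1 - z) *
    (g0%:~R + g1%:~R * z + g2%:~R * z ^+ 2 + g3%:~R * z ^+ 3) - b%:~R * (z + z ^+ 3).
    by rewrite -k; ring.
  rewrite k2.
  have -> : 2 * (1 - z) * (g0%:~R + g1%:~R * z + g2%:~R * z ^+ 2 + g3%:~R * z ^+ 3)
    = 2 * (g0%:~R + (g1%:~R - g0%:~R) * z + (g2%:~R - g1%:~R) * z ^+ 2 + (g3%:~R - g2%:~R) * z
      ^+ 3 - g3%:~R * z ^+ 4) by ring.
  by rewrite z4; ring.
(* The coefficients give [a + q = 2 (g0 + g3)], [g2 = g1] and [g1 - g0 = g3 - g2]; hence
   [g0 + g3 = 2 g1] and [a + q = 4 g1]. *)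
move=> h0 h1 h2 h3; apply/dvdzP; exists g1; move: (Posz #|F|) h0 => Q h0. clear -h0 h1 h2 h3.
  have h4 : 2 * (g2 - g1) = 0 by rewrite -[RHS]oppr0 -h2 mulNr opprK. lia.
Qed.
End Evaluation.

(** * Lifting Jacobi sums modulo p^2 *)

(* [frobV p] is [((1 - X) ^ p - (1 - X ^ p)) / p] for odd [p]. *)
Definition frobV (p : nat) : {poly int} :=
  \sum_(1 <= i < p) (((-1) ^+ i * ('C(p, i) %/ p)%N%:Z) *: 'X^i).

Lemma frobV_eq (p : nat) (R : comNzRingType) (t : R) : prime p -> odd p ->
  (1 - t) ^+ p = (1 - t ^+ p) + p%:R * (map_poly intr (frobV p)).[t].
Proof.
move=> pp op; have p0 := prime_gt0 pp.
rewrite exprBn -(big_mkord xpredT (fun i => ((-1) ^+ i * 1 ^+ (p - i) * t ^+ i) *+ 'C(p, i))).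
rewrite big_nat_recr //= big_ltn //= expr0 subn0 !expr1n bin0 binn !mulr1 !mulr1n.
rewrite -signr_odd op expr1 mulN1r addrAC; congr (_ + _).
rewrite rmorph_sum /= horner_sum mulr_sumr; apply: eq_big_nat => i /andP[i0 ip].
rewrite map_polyZ map_polyXn /= hornerZ hornerXn rmorphM /= rmorphXn rmorphN1 expr1n mulr1.
rewrite -[X in _ = _ * (_ * X * _)]/(('C(p, i) %/ p)%:R).
have /divnK {1}<- : (p %| 'C(p, i))%N by rewrite prime_dvd_bin // i0.
rewrite -mulr_natl natrM; ring.
Qed.

Section LocalLift.
Variables (p : nat) (F : finFieldType) (g : F) (A : comNzRingType) (pi : {rmorphism A -> F}).
Local Notation q := #|F|.
Hypotheses (pp : prime p) (op : odd p) (cardF : q = (p ^ 2)%N).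
Hypothesis hg : (q.-1).-primitive_root g.
Hypothesis A0 : (p ^ 2)%:R = 0 :> A.
Hypothesis kerpi : forall u, pi u = 0 -> exists v, u = p%:R * v.

Lemma natp0 : p%:R = 0 :> F.
Proof. by have := rmorph_nat pi (p ^ 2); rewrite A0 rmorph0 natrX => /esym /eqP;
  rewrite sqrf_eq0 => /eqP. Qed.

(** In [u ^ p - v ^ p = (u - v) * S] both factors reduce to 0 in [F], the second one to [p] equal
    terms; each is thus a multiple of [p], and [p ^ 2 = 0]. *)
Lemma lift_expp u v : pi u = pi v -> u ^+ p = v ^+ p.
Proof.
move=> uv; apply/eqP; rewrite -subr_eq0 subrXX.
have [w ->] : exists w, u - v = p%:R * w by apply: kerpi; rewrite rmorphB uv subrr.
have [w' ->] : exists w', \sum_(i < p) u ^+ (p.-1 - i) * v ^+ i = p%:R * w'.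
  apply: kerpi; rewrite rmorph_sum /= (eq_bigr (fun=> pi v ^+ p.-1)) => [|i _].
    by rewrite sumr_const card_ord -mulr_natl natp0 mul0r.
  by rewrite rmorphM !rmorphXn uv -exprD subnK // -ltnS prednK // prime_gt0.
by rewrite mulrACA -natrM mulnn A0 mul0r.
Qed.

Lemma lift_unity u : pi u != 0 -> u ^+ (q.-1 * p) = 1.
Proof.
move=> hu; rewrite exprM -[RHS](expr1n _ p); apply: lift_expp.
rewrite rmorphXn rmorph1 /=; apply: (mulfI hu).
by rewrite -exprS mulr1 prednK ?expf_card // ltnW // finNzRing_gt1.
Qed.

Lemma lift_regular u w : pi u != 0 -> u * w = 0 -> w = 0.
Proof.
move=> hu uw; rewrite -[w]mul1r -(lift_unity hu).
have : (0 < q.-1 * p)%N by rewrite muln_gt0 (prim_order_gt0 hg) prime_gt0.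
by case: (_ * _)%N => // m _; rewrite exprSr -mulrA uw mulr0.
Qed.

Lemma two_neq0 : 2 != 0 :> F.
Proof.
have pF : p \in [pchar F] by rewrite inE pp natp0 eqxx.
by rewrite -(dvdn_pcharf pF) gtnNdvd //; case: p pp op => [|[|[|]]].
Qed.

Lemma lift_sqr1 s b : s ^+ 2 = 1 -> pi s = (-1) ^+ b -> s = (-1) ^+ b.
Proof.
move=> s2 ps; apply/eqP; rewrite -subr_eq0; apply/eqP.
apply: (@lift_regular (s + (-1) ^+ b)).
  rewrite rmorphD /= ps rmorphXn rmorphN1 -mulr2n -mulr_natl mulf_neq0 ?two_neq0 //.
  by rewrite expf_neq0 // oppr_eq0 oner_neq0.
by rewrite mulrC -subr_sqr s2 exprAC sqrrN !expr1n subrr.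
Qed.

Variable alpha : A.
Hypotheses (pi_alpha : pi alpha = g) (alphaq : alpha ^+ q.-1 = 1).

Lemma natq1 : (q.-1)%:R = -1 :> A.
Proof.
apply/eqP; rewrite -subr_eq0 opprK natr1 prednK ?cardF ?A0 //.
by rewrite expn_gt0 prime_gt0.
Qed.

(** Orthogonality of characters in [A]: a nontrivial sum is killed by the regular element
    [alpha ^ k - 1], and the trivial one is [q - 1 = -1] because [q = 0] in [A]. This sign is the
    one that relates [J] to minus a coefficient. *)
Lemma sum_alpha k : \sum_(j < q.-1) (alpha ^+ k) ^+ j = - (q.-1 %| k)%:R.
Proof.
case: (boolP (q.-1 %| k)%N) => hk.
  case/dvdnP: hk => m ->; rewrite mulnC exprM alphaq expr1n.
  by under eq_bigr => j _ do rewrite expr1n; rewrite sumr_const card_ord natq1.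
rewrite oppr0; apply: (@lift_regular (alpha ^+ k - 1)).
  rewrite rmorphB rmorph1 rmorphXn pi_alpha subr_eq0.
  by apply: contraNneq hk => h; rewrite (prim_order_dvd hg) h.
by rewrite -subrX1 exprAC alphaq expr1n subrr.
Qed.

Lemma sum_alpha_poly (P : {poly int}) c e m : (size P <= q.-1)%N -> (m < q.-1)%N ->
  (forall k, (k < q.-1)%N -> (q.-1 %| c + e * k)%N = (k == m)) ->
  \sum_(j < q.-1) (alpha ^+ c) ^+ j * (map_poly intr P).[(alpha ^+ e) ^+ j] = - (P`_m)%:~R.
Proof.
move=> sP mq hk.
have sP' : (size (map_poly intr P : {poly A}) <= q.-1)%N by apply: leq_trans (size_poly _ _) sP.
under eq_bigr => j _ do rewrite (horner_coef_wide _ sP') mulr_sumr.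
have e1 (x : A) (j k : nat) : (alpha ^+ c) ^+ j * (x * ((alpha ^+ e) ^+ j) ^+ k) =
  x * (alpha ^+ (c + e * k)) ^+ j.
  by rewrite mulrCA exprD exprMn -!exprM !mulnA [(e * k * j)%N]mulnAC.
rewrite exchange_big (bigD1 (Ordinal mq)) //= [X in _ + X]big1 ?addr0.
  under eq_bigr => j _ do rewrite e1.
  by rewrite -mulr_sumr sum_alpha hk // eqxx mulrN1 coef_map.
move=> k km.
under eq_bigr => j _ do rewrite e1.
rewrite -mulr_sumr sum_alpha hk //.
by rewrite -val_eqE /= in km; rewrite (negPf km) oppr0 mulr0.
Qed.

(* [qchi (1 - t)] is the Teichmueller lift of the quadratic character, and [u ^+ p] only
   depends on [u] modulo [p]: both binomials may be raised to the power [p]. *)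
Lemma qchi_lift n j : p = (2 * n + 1)%N ->
  qchi g A (1 - g ^+ j) = (1 - (alpha ^+ j) ^+ p) ^+ (p * n) * (1 - alpha ^+ j) ^+ (p * n).
Proof.
move=> ep; have n0 : (0 < n)%N by have := prime_gt1 pp; lia.
set t := alpha ^+ j; have pt : pi t = g ^+ j by rewrite rmorphXn /= pi_alpha.
have [gj|gj] := eqVneq (1 - g ^+ j) 0.
  have -> : t = 1.
    move/eqP: gj; rewrite subr_eq0 eq_sym -(prim_order_dvd hg) => /dvdnP[m ej].
    by rewrite /t ej mulnC exprM alphaq expr1n.
  by rewrite gj /qchi /chi eqxx expr1n subrr expr0n muln_eq0 !eqn0Ngt prime_gt0 // n0 mul0r.
pose w := 1 - t.
have pw : pi w = 1 - g ^+ j by rewrite rmorphB rmorph1 pt.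
have pF : p \in [pchar F] by rewrite inE pp natp0 eqxx.
have e1 : (1 - t ^+ p) ^+ p = (w ^+ p) ^+ p.
  apply: lift_expp; rewrite rmorphB rmorphXn rmorph1 pt /= rmorphXn pw.
  by rewrite -!(pFrobenius_autE pF) rmorphB rmorph1.
rewrite exprM e1 -/w -!exprM -exprD.
(* As [n (p + 1) = (q - 1) / 2], this is the [p]-th power of Euler's criterion: its square is 1 by
   [lift_unity], and the residue fixes the sign. *)
rewrite (_ : (_ + _)%N = (p * (n * p.+1))%N); last by lia.
have e3 : (2 * (n * p.+1) = q.-1)%N by rewrite cardF ep; lia.
rewrite /qchi /chi (negPf gj); symmetry; rewrite mulnC exprM -signr_odd.
apply: lift_sqr1.
  by rewrite -!exprM -[RHS](lift_unity (u := w)) ?pw // -e3; congr (_ ^+ _); lia.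
rewrite !rmorphXn /= pw -{1}(dlogK hg gj) -!exprM.
have ghalf : g ^+ (n * p.+1) = -1.
  have /eqP : (g ^+ (n * p.+1)) ^+ 2 = 1 by rewrite -exprM mulnC e3 (prim_expr_order hg).
  rewrite sqrf_eq1 => /orP[|/eqP //]; rewrite -(prim_order_dvd hg) => /dvdn_leq.
  by rewrite -e3; lia.
move: (dlog g _) => l; rewrite (_ : (_ * _)%N = (n * p.+1 * (l * p))%N); last by lia.
by rewrite exprM ghalf -[LHS]signr_odd oddM op andbT.
Qed.

(* For [t] a Teichmueller element, [t ^ (p ^ 2) = t] and
   [(1 - t ^ p) ^ (p n) * (1 - t) ^ (p n)] is [jacP0 n + p n (jacB n + jacB n (X ^ p))] at [t]. *)
Definition jacP0 (n : nat) : {poly int} := (1 - 'X) ^+ n * ((1 - 'X) ^+ n \Po 'X^p).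
Definition jacB (n : nat) : {poly int} := frobV p * (1 - 'X) ^+ n * ((1 - 'X) ^+ n.-1 \Po 'X^p).

Lemma size_1subX (n : nat) : size ((1 - 'X : {poly int}) ^+ n) = n.+1.
Proof.
have -> : 1 - 'X = - ('X - 1%:P) :> {poly int} by rewrite opprB.
by rewrite exprNn -signr_odd; case: odd; rewrite ?mulN1r ?mul1r ?size_polyN size_exp_XsubC.
Qed.

Lemma size_compXp (n : nat) : (size ((1 - 'X : {poly int}) ^+ n \Po 'X^p) <= (n * p).+1)%N.
Proof.
have := size_comp_poly ((1 - 'X : {poly int}) ^+ n) 'X^p.
by rewrite size_1subX size_polyXn /= => <-; exact: leqSpred.
Qed.

Lemma size_frobV : (size (frobV p) <= p)%N.
Proof.
apply: leq_trans (size_sum _ _ _) _; rewrite big_nat; apply/bigmax_leqP_seq => i _ /andP[_ ip].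
by apply: leq_trans (size_scale_leq _ _) _; rewrite size_polyXn.
Qed.

Lemma exprD_p (x v : A) n : (x + p%:R * v) ^+ n = x ^+ n + p%:R * n%:R * v * x ^+ n.-1.
Proof.
elim: n => [|n IH]; first by rewrite !expr0 mulr0 mul0r mul0r addr0.
have A0' : p%:R * p%:R = 0 :> A by rewrite -natrM mulnn.
rewrite exprS IH mulrDl !mulrDr /= exprS -natr1.
have -> : p%:R * v * (p%:R * n%:R * v * x ^+ n.-1) =
  (p%:R * p%:R) * (v * n%:R * v * x ^+ n.-1) by ring.
rewrite A0' mul0r addr0; case: n IH => [|n] _ /=; first by rewrite expr0; ring.
by rewrite exprS; ring.
Qed.

(** The exponent [7 M] stands for [- M] modulo [q - 1]: summing against its powers extracts the
    coefficient of [X ^ M]. *)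
Lemma alpha_zeta8 M : (8 * M = q.-1)%N -> (alpha ^+ (7 * M)) ^+ 4 = -1.
Proof.
move=> eM; have q0 : (0 < q.-1)%N := prim_order_gt0 hg.
rewrite -exprM (_ : (7 * M * 4 = 4 * M * 7)%N); last by lia.
rewrite exprM (_ : alpha ^+ (4 * M) = -1); first by rewrite -signr_odd.
apply: (@lift_sqr1 _ true); first by rewrite -exprM (_ : (4 * M * 2 = q.-1)%N) //; lia.
rewrite rmorphXn /= pi_alpha.
have /eqP : (g ^+ (4 * M)) ^+ 2 = 1.
  by rewrite -exprM (_ : (4 * M * 2 = q.-1)%N) ?(prim_expr_order hg) //; lia.
rewrite sqrf_eq1 => /orP[|/eqP -> //]; rewrite -(prim_order_dvd hg) => /dvdn_leq.
by rewrite -eM; lia.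
Qed.

(** The quadratic character at [1 - t] is a polynomial in [t] plus [p n jacB (t ^ p)]. The sum
    extracts the coefficient at [M] from the former; in the latter, [p k = M] modulo [q - 1] selects
    [k = M']. The degrees of [jacP0] and [jacB] stay below [q - 1], so exponents are not
    confused. *)
Lemma oct_sum_lift n M M' : p = (2 * n + 1)%N -> (8 * M = q.-1)%N -> (M' < q.-1)%N ->
  (p * M' = M %[mod q.-1])%N ->
  oct_sum g (alpha ^+ (7 * M)) = -
    ((jacP0 n)`_M + p%:Z * n%:Z * ((jacB n)`_M + (jacB n)`_M'))%:~R.
Proof.
move=> ep eM M'q pM'.
have e3 : (2 * (n * p.+1) = q.-1)%N by rewrite cardF ep; lia.
have n0 : (0 < n)%N by have := prime_gt1 pp; lia.
have q0 : (0 < q.-1)%N := prim_order_gt0 hg.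
have q8 : (8 %| q.-1)%N by rewrite -eM dvdn_mulr.
have z4 := alpha_zeta8 eM.
rewrite oct_sumE //.
pose term (t : A) := (map_poly intr (jacP0 n)).[t] + p%:R * n%:R *
  ((map_poly intr (jacB n)).[t] + (map_poly intr (jacB n)).[t ^+ p]).
have eterm j : qchi g A (1 - g ^+ j) = term (alpha ^+ j).
  rewrite (qchi_lift _ ep); set t := alpha ^+ j.
  have tq : (t ^+ p) ^+ p = t.
    have : t ^+ q = t by rewrite -[q]prednK ?cardF ?expn_gt0 ?prime_gt0 // -cardF exprS /t
      exprAC alphaq expr1n mulr1.
    by rewrite -exprM mulnn -cardF.
  rewrite !exprM (frobV_eq t pp op) (frobV_eq (t ^+ p) pp op) tq !exprD_p.
  rewrite /term /jacP0 /jacB !rmorphM /= !map_comp_poly !rmorphXn !rmorphB !rmorph1 /= !map_polyX.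
  rewrite !(hornerM, horner_comp, horner_exp, hornerXn, hornerD, hornerN, hornerX, hornerC) tq.
  set v := horner _ t; set v' := horner _ _.
  have A0' : p%:R * p%:R = 0 :> A by rewrite -natrM mulnn.
  set x := 1 - t; set y := 1 - t ^+ p.
  rewrite mulrDl !mulrDr.
  have -> : p%:R * n%:R * v' * x ^+ n.-1 * (p%:R * n%:R * v * y ^+ n.-1) =
    (p%:R * p%:R) * (n%:R * v' * x ^+ n.-1 * (n%:R * v * y ^+ n.-1)) by ring.
  rewrite A0' mul0r addr0; ring.
under eq_bigr => j _ do rewrite eterm /term mulrDr mulrCA mulrDr.
rewrite big_split /= -mulr_sumr big_split /=.
have h2 (j : 'I_(q.-1)) : true -> (alpha ^+ (7 * M)) ^+ j *
  (map_poly intr (jacB n)).[(alpha ^+ j) ^+ p]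
  = (alpha ^+ (7 * M)) ^+ j * (map_poly intr (jacB n)).[(alpha ^+ p) ^+ j] by rewrite
    [(alpha ^+ j) ^+ p]exprAC.
rewrite [X in _ + _ * (_ + X)](eq_bigr _ h2).
have sB : (size (jacB n) <= q.-1)%N.
  rewrite /jacB -mulrA; apply: leq_trans (size_polyMleq _ _) _.
  have h := size_polyMleq ((1 - 'X : {poly int}) ^+ n) ((1 - 'X) ^+ n.-1 \Po 'X^p).
  rewrite size_1subX in h; have h1 := size_compXp n.-1; have h3 := size_frobV.
  move: h h1 h3; set s1 := size _; set s2 := size _; set s3 := size _ => h h1 h3.
  have h4 : (n.-1 * p + p = n * p)%N by rewrite -mulSnr prednK.
  rewrite -e3 mulnS; move: (n.-1 * p)%N (n * p)%N h h1 h4 => N NP h h1 h4; lia.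
have sP : (size (jacP0 n) <= q.-1)%N.
  rewrite /jacP0; apply: leq_trans (size_polyMleq _ _) _.
  have h1 := size_compXp n; rewrite size_1subX -e3.
  by rewrite mulnS; move: (size _) (n * p)%N h1 => s1 NP h1; lia.
have Mq : (M < q.-1)%N by lia.
have hdiv k : (q.-1 %| 7 * M + k)%N = (k == M %[mod q.-1])%N.
  by rewrite -(eqn_modDl (7 * M)) -mulSnr eM modnn.
have div1 k : (k < q.-1)%N -> (q.-1 %| 7 * M + 1 * k)%N = (k == M).
  by move=> kq; rewrite mul1n hdiv !modn_small.
have divp k : (k < q.-1)%N -> (q.-1 %| 7 * M + p * k)%N = (k == M').
  move=> kq.
  rewrite hdiv -pM'; have cop : coprime q.-1 p.
    rewrite coprime_sym prime_coprime //; apply/negP => /dvdnP[m em].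
    have : (p ^ 2 = m * p + 1)%N by rewrite -em -cardF addn1 prednK // cardF expn_gt0 prime_gt0.
    move=> e; have : (p %| m * p + 1)%N by rewrite -e dvdn_exp.
    by rewrite dvdn_addr ?dvdn_mull // dvdn1 => /eqP p1; have := pp; rewrite p1.
  case: (leqP M' k) => h.
    rewrite eqn_mod_dvd ?leq_mul2l ?h ?orbT // -mulnBr Gauss_dvdr //.
    apply/idP/eqP => [|->]; last by rewrite subnn dvdn0.
    have [e0 _|hn] := posnP (k - M')%N; first by move: e0 h; clear; lia.
    by move/(dvdn_leq hn) => le; move: le kq hn; clear; lia.
  rewrite eq_sym eqn_mod_dvd ?leq_mul2l ?(ltnW h) ?orbT // -mulnBr Gauss_dvdr //.
  have hn : (0 < M' - k)%N by rewrite subn_gt0.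
  apply/idP/eqP => [/(dvdn_leq hn) le|e].
    by move: le M'q hn; clear; lia.
  by move: e hn; clear; lia.
have := sum_alpha_poly sP Mq div1; rewrite expr1 => ->.
have := sum_alpha_poly sB Mq div1; rewrite expr1 => ->.
rewrite (sum_alpha_poly sB M'q divp).
by rewrite rmorphD !rmorphM rmorphD /= -[(p%:Z)%:~R]/(p%:R) -[(n%:Z)%:~R]/(n%:R); ring.
Qed.

End LocalLift.

(** * Construction of the Galois ring *)

Section PrimeField.
Variables (p : nat) (F : finFieldType).
Hypotheses (pp : prime p) (p0 : p%:R = 0 :> F).

Lemma natF_eq0 k : (k%:R == 0 :> F) = (p %| k)%N.
Proof.
have pF : p \in [pchar F] by rewrite inE pp p0 eqxx.
by rewrite (dvdn_pcharf pF).
Qed.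

Lemma prime_subfield (x : F) : x ^+ p = x -> exists k : nat, x = k%:R.
Proof.
move=> xp; pose rs := [seq k%:R : F | k <- iota 0 p].
have pF : p \in [pchar F] by rewrite inE pp p0 eqxx.
have sP : size ('X^p - 'X : {poly F}) = p.+1.
  by rewrite size_polyDl size_polyXn // size_polyN size_polyX ltnS prime_gt1.
have urs : uniq rs.
  rewrite map_inj_in_uniq ?iota_uniq // => k l; rewrite !mem_iota !add0n /=.
  wlog le : k l / (k <= l)%N.
    by move=> h; case: (leqP k l) => hkl hk hl e; [exact: h | symmetry; apply: h => //;
      exact: ltnW].
  move=> hk hl e; have : ((l - k)%N%:R == 0 :> F) by rewrite natrB // e subrr.
  rewrite natF_eq0 => d; case: (posnP (l - k)) => [|h]; first by lia.
  by have := dvdn_leq h d; lia.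
have root_rs : all (root ('X^p - 'X)) rs.
  apply/allP => y /mapP[k _ ->]; rewrite rootE !hornerE.
  by rewrite -(pFrobenius_autE pF) pFrobenius_aut_nat subrr.
have [/mapP[k _ ->]|nx] := boolP (x \in rs); first by exists k.
have P0 : 'X^p - 'X != 0 :> {poly F} by rewrite -size_poly_gt0 sP.
have := @max_poly_roots _ _ (x :: rs) P0.
rewrite /= nx urs root_rs andbT sP size_map size_iota ltnn => h.
by move: h; rewrite rootE !hornerE xp subrr eqxx => /(_ isT isT).
Qed.

End PrimeField.

(* Satisfied by the Galois ring of characteristic [p ^ 2] with residue field [F]. *)
Definition localring_spec (p : nat) (F : finFieldType) (g : F) : Prop :=
  exists (A : comNzRingType) (pi : {rmorphism A -> F}) (a : A),
  [/\ (p ^ 2)%:R = 0 :> A,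
      forall u, pi u = 0 -> exists v, u = p%:R * v,
      pi a = g
    & forall m : nat, m%:R = 0 :> A -> (p ^ 2 %| m)%N].

Section Construction.
Variables (p : nat) (F : finFieldType) (g : F).
Hypotheses (pp : prime p) (cardF : #|F| = (p ^ 2)%N).
Hypothesis hg : (#|F|.-1).-primitive_root g.

Let pF : p \in [pchar F]. Proof. exact: card_finPcharP cardF pp. Qed.
Let p0 : p%:R = 0 :> F. Proof. exact: pcharf0 pF. Qed.
Local Notation Zq := 'Z_(p ^ 2).
Let q1 : (1 < p ^ 2)%N. Proof. by rewrite -(exp1n 2) ltn_exp2r // prime_gt1. Qed.
Let Zqc : (Zp_trunc (p ^ 2)).+2 = (p ^ 2)%N. Proof. exact: Zp_cast. Qed.

Definition zp_proj (z : Zq) : F := (val z)%:R.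

Lemma natF_mod m : (m %% (Zp_trunc (p ^ 2)).+2)%:R = m%:R :> F.
Proof. by rewrite Zqc {2}(divn_eq m (p ^ 2)) natrD natrM natrX p0 expr0n mulr0 add0r. Qed.

Lemma zp_proj_zmod : zmod_morphism zp_proj.
Proof.
have zp_projD x y : zp_proj (x + y) = zp_proj x + zp_proj y.
  by rewrite /zp_proj -natrD -[RHS]natF_mod.
by move=> x y; apply: (addIr (zp_proj y)); rewrite -zp_projD !subrK.
Qed.

Lemma zp_proj_monoid : monoid_morphism zp_proj.
Proof.
split; first by rewrite /zp_proj /= natF_mod.
by move=> x y; rewrite /zp_proj -natrM -[RHS]natF_mod.
Qed.

HB.instance Definition _ := GRing.isZmodMorphism.Build Zq F zp_proj zp_proj_zmod.
HB.instance Definition _ := GRing.isMonoidMorphism.Build Zq F zp_proj zp_proj_monoid.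

Lemma zp_proj_ker z : zp_proj z = 0 -> exists v, z = p%:R * v.
Proof.
move/eqP; rewrite (natF_eq0 pp p0) => /dvdnP[k ek].
by exists k%:R; rewrite -natrM mulnC -ek natr_Zp.
Qed.

(** A nontrivial relation would put [g] into the prime field, so its order [p ^ 2 - 1] would divide
    [p - 1]. *)
Lemma prim_root_free (a b : Zq) : zp_proj a + zp_proj b * g = 0 -> zp_proj a = 0 /\ zp_proj b = 0.
Proof.
move=> e; have [b0|b0] := eqVneq (zp_proj b) 0.
  by move: e; rewrite b0 mul0r addr0.
have fix_proj z : zp_proj z ^+ p = zp_proj z.
  by rewrite -(pFrobenius_autE pF) /zp_proj pFrobenius_aut_nat.
have eg : g = - zp_proj a / zp_proj b by apply: (mulIf b0); rewrite divfK // mulrC; apply/eqP;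
  rewrite -addr_eq0 addrC e.
have gp : g ^+ p = g.
  by rewrite eg expr_div_n !fix_proj -(pFrobenius_autE pF) rmorphN /= (pFrobenius_autE pF)
    fix_proj.
have := prim_order_dvd hg p.-1.
have -> : g ^+ p.-1 == 1.
  have g0 : g != 0 by have := gexp_neq0 hg 1; rewrite expr1.
  by apply/eqP; apply: (mulfI g0); rewrite -exprS prednK ?prime_gt0 // mulr1.
move/dvdn_leq; have := prime_gt1 pp; rewrite cardF => h1 /(_ _); nia.
Qed.

(** The ring is the quotient of polynomials over [Z/p^2] by a lift [h] of
    [X^2 - (g + g^p) X + g^(p+1)], the minimal polynomial of [g], whose coefficients are fixed by
    Frobenius. An element [u0 + u1 X] sent to 0 has both coefficients divisible by [p], by
    [prim_root_free]. *)
Lemma localring_exists : localring_spec p g.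
Proof.
have frob2 x : x ^+ p ^+ p = x :> F by rewrite -exprM mulnn -cardF expf_card.
have frobE x : x ^+ p = pFrobenius_aut pF x by rewrite pFrobenius_autE.
have [s es] : exists s : nat, - (g + g ^+ p) = s%:R.
  apply: (prime_subfield pp p0); rewrite frobE rmorphN rmorphD /= -!frobE frob2.
  by rewrite addrC.
have [r er] : exists r : nat, g ^+ p * g = r%:R.
  by apply: (prime_subfield pp p0); rewrite exprMn frob2 mulrC.
pose h : {poly Zq} := 'X^2 + (s%:R *: 'X + r%:R%:P).
have sh' : (size (s%:R *: 'X + r%:R%:P : {poly Zq})%R < 3)%N.
  rewrite ltnS; apply: leq_trans (size_polyD _ _) _; rewrite geq_max.
  by rewrite (leq_trans (size_scale_leq _ _)) ?size_polyX // (leq_trans (size_polyC_leq1 _)).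
have sh : size h = 3%N by rewrite /h size_polyDl size_polyXn.
have mh : h \is monic by rewrite monicE /h lead_coefDl ?size_polyXn // lead_coefXn.
(* The quotient type divides by [mk_monic h], which leaves a nonconstant monic polynomial
   unchanged. *)
have emk : mk_monic h = h by rewrite /mk_monic sh mh.
have smk : size (mk_monic h) = 3%N by rewrite emk.
have zp_projN (m : nat) : zp_proj m%:R = m%:R by rewrite rmorph_nat.
have hg0 : (map_poly zp_proj h).[g] = 0.
  rewrite /h !rmorphD /= map_polyXn map_polyZ map_polyX map_polyC /= !hornerE !zp_projN -es -er.
  by rewrite -[LHS]/(g ^+ 2 + - (g + g ^+ p) * g + g ^+ p * g); ring.
pose pi (u : {poly %/ h}) : F := (map_poly zp_proj (u : {poly Zq})).[g].
have pi_mod (P : {poly Zq}) : (map_poly zp_proj (Pdiv.CommonRing.rmodp P (mk_monic h))).[g] =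
  (map_poly zp_proj P).[g].
  by rewrite emk {2}(Pdiv.RingMonic.rdivp_eq mh P) rmorphD rmorphM /= !hornerE hg0 mulr0 add0r.
have pi_zmod : zmod_morphism pi.
  by move=> u v; rewrite /pi /= rmorphB hornerD hornerN.
have pi_monoid : monoid_morphism pi.
  split; first by rewrite /pi /= map_polyC /= rmorph1 hornerC.
  by move=> u v; rewrite /pi poly_of_qpolyM pi_mod rmorphM hornerM.
pose piZ := GRing.isZmodMorphism.Build {poly %/ h} F pi pi_zmod.
pose piM := GRing.isMonoidMorphism.Build {poly %/ h} F pi pi_monoid.
pose piR : {rmorphism {poly %/ h} -> F} := HB.pack pi piZ piM.
exists {poly %/ h}, piR, ('qX : {poly %/ h}); split.
- apply: val_inj => /=; rewrite qpolyC_natr -polyC_natr.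
  by rewrite pchar_Zp // rmorph0.
- move=> u; have su : (size (u : {poly Zq}) <= 2)%N.
    by rewrite -ltnS; apply: (leq_trans (size_mk_monic u)); rewrite smk.
  have eu : (u : {poly Zq}) = ((u : {poly Zq})`_0)%:P + ((u : {poly Zq})`_1) *: 'X.
    apply/polyP => i; rewrite coefD coefC coefZ coefX.
    case: i => [|[|i]] /=; rewrite ?mulr0 ?mulr1 ?addr0 ?add0r //.
    by rewrite nth_default // (leq_trans su).
  rewrite /= /pi eu rmorphD /= map_polyC map_polyZ map_polyX /= !hornerE => /prim_root_free[h0
    h1].
  have [v0 e0] := zp_proj_ker h0; have [v1 e1] := zp_proj_ker h1.
  exists (in_qpoly h (v0%:P + v1 *: 'X)).
  apply: val_inj; rewrite [RHS]poly_of_qpolyM qpolyC_natr.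
  rewrite in_qpoly_small; last first.
    rewrite smk ltnS; apply: leq_trans (size_polyD _ _) _; rewrite geq_max.
    by rewrite (leq_trans (size_polyC_leq1 _)) // (leq_trans (size_scale_leq _ _)) ?size_polyX.
  have -> : p%:R * (v0%:P + v1 *: 'X) = (u : {poly Zq}).
    by rewrite [RHS]eu e0 e1 mulrDr polyCM -scalerA polyC_natr !mulr_natl scaler_nat.
  by rewrite Pdiv.CommonRing.rmodp_small // size_mk_monic.
- by rewrite /= /pi qpolyXE ?sh // map_polyX hornerX.
move=> m em; have := congr1 (fun u : {poly %/ h} => (u : {poly Zq})) em.
rewrite /= qpolyC_natr -polyC_natr => /polyC_inj /(congr1 val) /=.
by rewrite val_Zp_nat // => /eqP.
Qed.
End Construction.

(** With [r = z + z ^ 3], so that [r ^ 2 = -2], the product of [a + b r] and [a - b r] is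
    [p ^ 2 = 0] in the Galois ring. The first factor equals [- Z], a unit by hypothesis, so the
    second vanishes and [2 a], their sum, is [- Z]. *)
Lemma oct_sum_mod_p2 (p n M M' : nat) : prime p -> p = (2 * n + 1)%N ->
  (8 * M = (p ^ 2).-1)%N -> (M' < (p ^ 2).-1)%N -> (p * M' = M %[mod (p ^ 2).-1])%N ->
  let Z := (jacP0 p n)`_M + p%:Z * n%:Z * ((jacB p n)`_M + (jacB p n)`_M') in
  ~~ (p%:Z %| Z)%Z ->
  exists a b : int, [/\ a ^+ 2 + 2 * b ^+ 2 = (p ^ 2)%N%:Z, (4 %| a + (p ^ 2)%N%:Z)%Z
    & ((p ^ 2)%N%:Z %| 2 * a + Z)%Z].
Proof.
move=> pp ep eM M'q pM' Z hZ.
have op : odd p by rewrite ep oddD oddM.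
have [F charF cardF] := PrimePowerField pp (isT : 0 < 2)%N.
have [g hg] := finField_prim_root F.
have [A [pi [a0 [A0 kerpi pia0 kerZ]]]] := localring_exists pp cardF hg.
have pi_a0 : pi a0 != 0 by rewrite pia0; have := gexp_neq0 hg 1; rewrite expr1.
(* The Teichmueller lift of [g]: raising to the power [q] fixes the residue and makes the order
   divide [q - 1]. *)
pose al := a0 ^+ (p ^ 2).
have pi_al : pi al = g by rewrite rmorphXn pia0 -cardF expf_card.
have alq : al ^+ #|F|.-1 = 1.
  rewrite -exprM (_ : (p ^ 2 * _)%N = ((#|F|.-1 * p) * p)%N); last by lia.
  by rewrite exprM (lift_unity pp A0 kerpi pi_a0) expr1n.
rewrite -cardF in eM M'q pM' *.
have q8 : (8 %| #|F|.-1)%N by rewrite -eM dvdn_mulr.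
have [a [b [hab hnorm h4]]] := oct_sum_representation hg q8.
exists a, b; split=> //.
have e := oct_sum_lift pp op cardF hg A0 kerpi pi_al alq ep eM M'q pM'.
have z4 := alpha_zeta8 pp op cardF hg A0 kerpi pi_al alq eM.
set z := al ^+ (7 * M) in e z4; rewrite (hab _ _ z4) -/Z in e.
have p0 : p%:R = 0 :> F := natp0 pi A0.
have pZ : pi (a%:~R + b%:~R * (z + z ^+ 3)) != 0.
  rewrite e rmorphN oppr_eq0 rmorph_int.
  move: hZ; rewrite dvdzE; case: (Z) => m.
    by rewrite /= -[(Posz m)%:~R]/(m%:R) (natF_eq0 pp p0).
  by rewrite NegzE mulrNz oppr_eq0 /= -[(Posz m.+1)%:~R]/(m.+1%:R) (natF_eq0 pp p0).
have conj0 : a%:~R - b%:~R * (z + z ^+ 3) = 0.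
  apply: (lift_regular pp hg A0 kerpi pZ).
  have -> : (a%:~R + b%:~R * (z + z ^+ 3)) * (a%:~R - b%:~R * (z + z ^+ 3))
     = a%:~R ^+ 2 - b%:~R ^+ 2 * (z ^+ 2 + 2 * z ^+ 4 + z ^+ 4 * z ^+ 2) by ring.
  rewrite z4; transitivity ((a ^+ 2 + 2 * b ^+ 2)%:~R : A).
    by rewrite rmorphD rmorphM !rmorphXn /=; ring.
  by rewrite hnorm cardF.
have e2 : (2 * a + Z)%:~R = 0 :> A.
  rewrite rmorphD rmorphM /=.
  have -> : 2 * a%:~R = (a%:~R + b%:~R * (z + z ^+ 3)) + (a%:~R - b%:~R * (z + z ^+ 3)) :> A by
    ring.
  by rewrite e conj0 addr0 addNr.
rewrite dvdzE cardF /=; apply: kerZ; move: e2; case: (2 * a + Z) => m //=.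
by rewrite NegzE mulrNz => /eqP; rewrite oppr_eq0 => /eqP.
Qed.

(** * Binomial coefficients and harmonic numbers *)

Lemma coef_1subXn (n k : nat) : ((1 - 'X : {poly int}) ^+ n)`_k = (-1) ^+ k * ('C(n, k))%:R.
Proof.
elim: n k => [|n IH] k.
  by rewrite expr0 coef1 bin0n; case: k => [|k]; rewrite ?expr0 ?mulr0 ?mulr1.
rewrite exprS mulrBl mul1r coefB coefXM !IH; case: k => [|k] /=.
  by rewrite !bin0 subr0.
by rewrite binS natrD exprS; ring.
Qed.

Lemma coef_mul_compXn (p : nat) (D E : {poly int}) m0 m1 :
  (m0 < p)%N -> (size D <= p)%N -> (D * (E \Po 'X^p))`_(m0 + p * m1) = D`_m0 * E`_m1.
Proof.
move=> m0p sD; have p0 : (0 < p)%N by apply: leq_ltn_trans m0p.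
have h : (m0 < (m0 + p * m1).+1)%N by rewrite ltnS leq_addr.
rewrite coefM (bigD1 (Ordinal h)) //= addKn coef_comp_poly_Xn // dvdn_mulr // mulKn //.
rewrite big1 ?addr0 // => j; rewrite -val_eqE /= => jm.
have [jp|jp] := ltnP j p; last by rewrite nth_default ?mul0r // (leq_trans sD).
rewrite coef_comp_poly_Xn //; case: ifP => [hd|_]; last by rewrite mulr0.
have lej : (j <= m0 + p * m1)%N by rewrite -ltnS.
case/negP: jm; apply/eqP.
have : (j == m0 %[mod p])%N.
  have em : (m0 + p * m1 = m0 %[mod p])%N by rewrite mulnC addnC modnMDl.
  by rewrite -em eq_sym eqn_mod_dvd.
by rewrite !modn_small // => /eqP.
Qed.

(** The part of [D] of degree at least [p] carries one unit into the digit [m1], whence the shifted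
    coefficient of [E]. *)
Lemma coef_mul_compXn2 (p : nat) (D E : {poly int}) m0 m1 :
  (m0 < p)%N -> (size D <= p + p)%N ->
  (D * (E \Po 'X^p))`_(m0 + p * m1) =
    D`_m0 * E`_m1 + D`_(m0 + p) * (if m1 is m.+1 then E`_m else 0).
Proof.
move=> m0p sD; rewrite -{1}(poly_take_drop p D) mulrDl coefD.
rewrite coef_mul_compXn ?size_take_poly // coef_take_poly m0p; congr (_ + _).
rewrite mulrAC coefMXn; case: m1 => [|m]; first by rewrite muln0 addn0 m0p mulr0.
rewrite mulnS addnCA ltnNge leq_addr /= addKn coef_mul_compXn ?coef_drop_poly //.
by rewrite size_drop_poly leq_subLR.
Qed.

(** This is the integral of [(1 - t) ^ n] over [[0, 1]]. Absorbing [1 / (j + 1)] into the binomial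
    leaves the expansion of [(1 - 1) ^ (n + 1)] without its first term. *)
Lemma sum_alt_bin_inv n : \sum_(0 <= j < n.+1) (-1) ^+ j * ('C(n, j))%:R / j.+1%:R =
  n.+1%:R^-1 :> rat.
Proof.
have n0 : n.+1%:R != 0 :> rat by rewrite pnatr_eq0.
apply: (mulfI n0); rewrite divff // mulr_sumr.
have e j : n.+1%:R * ((-1) ^+ j * ('C(n, j))%:R / j.+1%:R) =
  - ((-1) ^+ j.+1 * ('C(n.+1, j.+1))%:R) :> rat.
  have j0 : j.+1%:R != 0 :> rat by rewrite pnatr_eq0.
  have := congr1 (fun m => m%:R : rat) (mul_bin_diag n.+1 j); rewrite !natrM /= => h.
  by apply: (mulIf j0); rewrite !mulrA divfK // mulrAC h exprS; ring.
rewrite (eq_bigr _ (fun j _ => e j)) sumrN.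
have := exprBn (1 : rat) 1 n.+1; rewrite subrr expr0n /=.
rewrite -(big_mkord xpredT (fun i => ((-1) ^+ i * 1 ^+ (n.+1 - i) * 1 ^+ i) *+ 'C(n.+1, i))).
rewrite big_nat_recl // expr0 bin0 !expr1n !mulr1 mulr1n.
move/eqP; rewrite eq_sym addrC addr_eq0 => /eqP h.
apply/eqP; rewrite eqr_oppLR -[X in _ == X]h; apply/eqP; apply: eq_bigr => j _.
by rewrite !expr1n !mulr1 mulr_natr.
Qed.

(** Both sides are the coefficient of [X ^ m] in [log (1 + X) (1 + X) ^ n], the derivative of
    [(1 + X) ^ n] in [n]. The proof is an induction by Pascal's rule. *)
Lemma sum_bin_harm n m : (m <= n)%N ->
  \sum_(0 <= j < m) (-1) ^+ j * ('C(n, m - j.+1))%:R / j.+1%:R =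
    ('C(n, m))%:R * (harm n - harm (n - m)).
Proof.
have hS k : harm k.+1 = harm k + k.+1%:R^-1 by rewrite /harm big_nat_recr.
elim: n m => [|n IH] [|m] //; rewrite ?ltnS => le.
- by rewrite big_nil subrr mulr0.
- by rewrite big_nil subn0 subrr mulr0.
have -> : \sum_(0 <= j < m.+1) (-1) ^+ j * ('C(n.+1, m.+1 - j.+1))%:R / j.+1%:R =
   \sum_(0 <= j < m.+1) (-1) ^+ j * ('C(n, m.+1 - j.+1))%:R / j.+1%:R +
   \sum_(0 <= j < m) (-1) ^+ j * ('C(n, m - j.+1))%:R / j.+1%:R :> rat.
  rewrite big_nat_recr //= [X in _ = X + _]big_nat_recr //= addrAC -big_split /=.
  congr (_ + _); last by rewrite subnn !bin0.
  apply: eq_big_nat => j /andP[_ jm]; rewrite -mulrDl -mulrDr -natrD; congr (_ * _ / _);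
    congr (_ %:R).
  by have -> : (m.+1 - j.+1 = (m - j.+1).+1)%N by lia; rewrite binS.
rewrite (IH m) // subSS hS.
(* For [m = n] the induction hypothesis does not reach [m + 1]; that sum is [sum_alt_bin_inv]. *)
have [lt|ge] := ltnP m n; last first.
  have -> : m = n by lia.
  rewrite (eq_big_nat _ _ (F2 := fun j => (-1) ^+ j * ('C(n, j))%:R / j.+1%:R)); last first.
    by move=> j /andP[_ jn]; rewrite subSS bin_sub.
  by rewrite sum_alt_bin_inv !binn subnn; ring.
rewrite IH //.
have nm0 : (n - m)%N%:R != 0 :> rat by rewrite pnatr_eq0 subn_eq0 -ltnNge.
have n0 : n.+1%:R != 0 :> rat by rewrite pnatr_eq0.
have e1 : harm (n - m) = harm (n - m.+1) + (n - m)%N%:R^-1.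
  by have -> : (n - m = (n - m.+1).+1)%N by lia; rewrite hS.
have e2 : ('C(n.+1, m.+1))%:R = ('C(n, m.+1))%:R + ('C(n, m))%:R :> rat by rewrite binS natrD.
have e3 : (n - m)%N%:R * ('C(n.+1, m.+1))%:R = n.+1%:R * ('C(n, m.+1))%:R :> rat.
  have := mul_bin_down n.+1 m.+1; rewrite subSS /= => h.
  by rewrite -!natrM h.
rewrite e1.
have e4 : ('C(n, m.+1))%:R = (n - m)%N%:R * ('C(n.+1, m.+1))%:R / n.+1%:R :> rat by rewrite e3
  mulrC mulKf.
have e5 : ('C(n, m))%:R = ('C(n.+1, m.+1))%:R - ('C(n, m.+1))%:R :> rat by rewrite e2; ring.
rewrite e5 e4; move: (harm _) (harm _) (('C(n.+1, m.+1))%:R) (n.+1%:R) ((n - m)%N%:R) n0 nm0.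
by move=> a b c x y x0 y0; field; rewrite x0 y0.
Qed.

Section Coef.
Variables (p n : nat).
Hypotheses (pp : prime p) (ep : p = (2 * n + 1)%N).
Let p0 : (0 < p)%N. Proof. exact: prime_gt0. Qed.
Let n0 : (0 < n)%N. Proof. have := prime_gt1 pp; lia. Qed.

Lemma pint_sign k : pint p ((-1) ^+ k).
Proof. by apply: pintX => //; exact: (pint_int pp (-1)). Qed.

Lemma punit_ltp s : (s.+1 < p)%N -> punit p s.+1%:R.
Proof. by move=> h; apply: punit_lt => //; lia. Qed.

Lemma bin_p1_cong k : (k < p)%N -> rat_congr_pow p 1 ('C(p.-1, k))%:R ((-1) ^+ k).
Proof.
elim: k => [|k IH] kp; first by rewrite bin0; apply: cong_refl.
have d : (p %| 'C(p, k.+1))%N by rewrite prime_dvd_bin.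
have e : ('C(p.-1, k.+1))%:R = ('C(p, k.+1))%:R - ('C(p.-1, k))%:R :> rat.
  by rewrite -{2}(prednK p0) binS natrD addrK.
rewrite e exprS mulN1r -[- (-1) ^+ k]add0r; apply: congB => //; last by apply: IH; exact: ltnW.
case/dvdnP: d => c ->; apply/congP; exists c%:R; first exact: pint_nat.
by rewrite subr0 expn1 natrM mulrC.
Qed.

Lemma coef_frobV j : (0 < j < p)%N -> (frobV p)`_j = (-1) ^+ j * ('C(p, j) %/ p)%N%:Z.
Proof.
case/andP=> j0 jp; rewrite /frobV coef_sum big_nat.
rewrite (eq_bigr (fun i => if i == j then (-1) ^+ j * ('C(p, j) %/ p)%N%:Z else 0)) => [|i _].
  rewrite -big_mkcondr -big_filter /= (_ : filter _ _ = [:: j]) ?big_seq1 //.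
  rewrite -(filter_pred1_uniq (iota_uniq 1 (p - 1)) (_ : j \in _)) ?mem_iota; last by lia.
  by apply: eq_filter => i /=; case: eqP => [->|]; rewrite ?andbF // j0 jp.
by rewrite coefZ coefXn eq_sym; case: eqP => [->|_]; rewrite ?mulr1 ?mulr0.
Qed.

Lemma coef_frobV0 j : ~~ (0 < j < p)%N -> (frobV p)`_j = 0.
Proof.
move=> h; rewrite /frobV coef_sum big_nat big1 // => i hi.
by rewrite coefZ coefXn; case: eqP => [e|_]; rewrite ?mulr0 //; rewrite e hi in h.
Qed.

(** Modulo [p], [frobV] is the truncated series of [log (1 - X)]; this is how harmonic numbers enter
    the Jacobi sum. *)
Lemma frobV_cong j : (j.+1 < p)%N -> rat_congr_pow p 1 ((frobV p)`_j.+1)%:~R (- j.+1%:R^-1).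
Proof.
move=> jp; rewrite coef_frobV ?ltnS ?leq0n //.
have j0 : j.+1%:R != 0 :> rat by rewrite pnatr_eq0.
have d : (p %| 'C(p, j.+1))%N by rewrite prime_dvd_bin.
have e : ('C(p, j.+1) %/ p)%N%:R = ('C(p.-1, j))%:R / j.+1%:R :> rat.
  apply: (mulIf j0); rewrite divfK //; apply: (mulIf (p_neq0 pp)).
  rewrite -!natrM mulnAC divnK // mulnC -(mul_bin_diag p j) mulnC //.
rewrite rmorphM rmorphXn rmorphN1 /= -[(Posz _)%:~R]/(('C(p, j.+1) %/ p)%N%:R) e.
have -> : - j.+1%:R^-1 = (-1) ^+ j.+1 * ((-1) ^+ j / j.+1%:R) :> rat.
  by rewrite mulrA -exprD addSn exprS -signr_odd addnn odd_double expr0 mulr1 mulN1r.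
apply: congMl => //; first exact: pint_sign.
apply: congMr => //; first by apply: punit_pint; apply: punitV; apply: punit_ltp.
by apply: bin_p1_cong; exact: ltnW.
Qed.

Let D : {poly int} := frobV p * (1 - 'X) ^+ n.

Lemma coefD_low m : (m <= n)%N -> rat_congr_pow p 1 (D`_m)%:~R
  ((-1) ^+ m * ('C(n, m))%:R * (harm n - harm (n - m))).
Proof.
move=> mn; rewrite /D coefM -mulrA -sum_bin_harm // mulr_sumr.
rewrite -(big_mkord xpredT (fun j => (frobV p)`_j * ((1 - 'X) ^+ n)`_(m - j))).
rewrite big_nat_recl // coef_frobV0 // mul0r add0r rmorph_sum /= !big_nat.
apply: cong_sum => // j /andP[_ jm].
rewrite coef_1subXn !rmorphM rmorphXn rmorphN1 rmorph_nat /=.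
have -> : (-1) ^+ m * ((-1) ^+ j * ('C(n, m - j.+1))%:R / j.+1%:R) =
  - j.+1%:R^-1 * ((-1) ^+ (m - j.+1) * ('C(n, m - j.+1))%:R) :> rat.
  rewrite -{1}(subnK jm) exprD exprS.
  have e : (-1) ^+ j * (-1) ^+ j = 1 :> rat by rewrite -exprMn mulrNN mulr1 expr1n.
  transitivity (- ((-1) ^+ j * (-1) ^+ j) * ((-1) ^+ (m - j.+1) * 'C(n, m - j.+1)%:R / j.+1%:R)
    : rat); first by ring.
  by rewrite e; ring.
apply: congMr => //; first by apply: pintM => //; [exact: pint_sign | exact: pint_nat].
by apply: frobV_cong; lia.
Qed.

(** Only the indices [m < j <= n] of the binomial factor contribute. There [1 / (p - i) = - 1 / i]
    modulo [p] reverses the logarithm, and [sum_bin_harm] applies with [n - m] in place of [m]. *)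
Lemma coefD_high m : (m <= n)%N -> rat_congr_pow p 1 (D`_(m + p))%:~R
  (- ((-1) ^+ m * ('C(n, m))%:R * (harm n - harm m))).
Proof.
move=> mn; rewrite /D coefMr.
rewrite -(big_mkord xpredT (fun j => (frobV p)`_(m + p - j) * ((1 - 'X) ^+ n)`_j)).
rewrite (@big_cat_nat _ _ _ m.+1) //=; last by lia.
rewrite big_nat big1 ?add0r; last first.
  by move=> j hj; rewrite coef_frobV0 ?mul0r //; lia.
rewrite (@big_cat_nat _ _ _ n.+1) //=; last by lia.
rewrite [X in _ + X]big_nat [X in _ + X]big1 ?addr0; last first.
  by move=> j hj; rewrite coef_1subXn bin_small ?mulr0 //; lia.
rewrite -(subnKC mn) -addSn -{1}[m.+1]add0n big_addn addnC addnK (subnKC mn).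
have e : ('C(n, m))%:R * (harm n - harm m) =
  ('C(n, n - m))%:R * (harm n - harm (n - (n - m))) :> rat.
  by rewrite bin_sub // subKn.
rewrite -mulrA e -sum_bin_harm ?leq_subr // mulr_sumr -sumrN rmorph_sum /= !big_nat.
apply: cong_sum => // i /andP[_ im].
rewrite coef_1subXn !rmorphM rmorphXn rmorphN1 rmorph_nat /=.
have -> : (n - m - i.+1 = n - (i + m.+1))%N by lia.
rewrite bin_sub; last by lia.
have -> : - ((-1) ^+ m * ((-1) ^+ i * ('C(n, i + m.+1))%:R / i.+1%:R)) =
  i.+1%:R^-1 * ((-1) ^+ (i + m.+1) * ('C(n, i + m.+1))%:R) :> rat.
  by rewrite exprD exprS; ring.
apply: congMr => //; first by apply: pintM => //; [exact: pint_sign | exact: pint_nat].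
have -> : (m + p - (i + m.+1) = (p - i.+2).+1)%N by lia.
apply: (@cong_trans _ pp _ (- (p - i.+2).+1%:R^-1)); first by apply: frobV_cong; lia.
have u1 : punit p i.+1%:R by apply: punit_ltp; lia.
have u2 : punit p (p - i.+2).+1%:R by apply: punit_ltp; lia.
apply: (congIr pp u1); apply: (congIr pp u2).
have [h1 _] := u1; have [h2 _] := u2.
have es : (p - i.+2).+1%:R = p%:R - i.+1%:R :> rat.
  by rewrite -natrB; [congr (_ %:R); lia | lia].
apply/congP; exists (- 1); first exact: (pint_int pp (-1)).
rewrite expn1 es in h2 *; move: (p%:R) (i.+1%:R) h1 h2 => P I h1 h2.
by field; rewrite h1 h2.
Qed.

(** The two summands are the terms without and with a carry; the factor [n] turns ['C(n - 1, m1)]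
    and ['C(n - 1, m1 - 1)] into [n - m1] and [m1] times ['C(n, m1)]. *)
Lemma jacB_cong m0 m1 : (m0 <= n)%N -> (m1 <= n)%N ->
  rat_congr_pow p 1 (n%:R * ((jacB p n)`_(m0 + p * m1))%:~R)
   ((-1) ^+ (m0 + m1) * ('C(n, m0))%:R * ('C(n, m1))%:R *
     ((n - m1)%N%:R * (harm n - harm (n - m0)) + m1%:R * (harm n - harm m0))).
Proof.
move=> h0 h1; rewrite /jacB -/D coef_mul_compXn2; first last.
- apply: leq_trans (size_polyMleq _ _) _; rewrite size_1subX.
  have := size_frobV p; move: (size _) => s hs; lia.
- by lia.
rewrite rmorphD !rmorphM /= [n%:R * (_ + _)]mulrDr [_ * (_ + m1%:R * _)]mulrDr.
have e1 : n%:R * (((1 - 'X : {poly int}) ^+ n.-1)`_m1)%:~R =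
  (-1) ^+ m1 * ((n - m1)%N%:R * ('C(n, m1))%:R) :> rat.
  rewrite coef_1subXn rmorphM rmorphXn rmorphN1 rmorph_nat /=.
  have := mul_bin_down n m1 => h.
  by rewrite -natrM -h natrM; ring.
have e2 : n%:R * (if m1 is m.+1 then ((1 - 'X : {poly int}) ^+ n.-1)`_m else 0)%:~R =
  - (-1) ^+ m1 * (m1%:R * ('C(n, m1))%:R) :> rat.
  case: m1 {h1 e1} => [|m]; first by rewrite mul0r !mulr0.
  rewrite coef_1subXn rmorphM rmorphXn rmorphN1 rmorph_nat /=.
  have := mul_bin_diag n m => h.
  by rewrite -natrM -h natrM exprS; ring.
rewrite ![n%:R * (_ * _)]mulrCA e1 e2 exprD.
set s := (-1) ^+ m0; set t := (-1) ^+ m1.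
have -> : s * t * ('C(n, m0))%:R * ('C(n, m1))%:R * ((n - m1)%N%:R * (harm n - harm (n - m0))) =
   (s * ('C(n, m0))%:R * (harm n - harm (n - m0))) * (t * ((n - m1)%N%:R * ('C(n, m1))%:R)) by
     ring.
have -> : s * t * ('C(n, m0))%:R * ('C(n, m1))%:R * (m1%:R * (harm n - harm m0)) =
   (- (s * ('C(n, m0))%:R * (harm n - harm m0))) * (- t * (m1%:R * ('C(n, m1))%:R)) by ring.
have ht : pint p t by exact: pint_sign.
apply: congD => //; apply: congMr => //.
- by do !apply: pintM => //; exact: pint_nat.
- exact: coefD_low.
- by do !apply: pintM => //; try exact: pintN; exact: pint_nat.
exact: coefD_high.
Qed.

Lemma jacP0_coef m0 m1 : (m0 <= n)%N -> (jacP0 p n)`_(m0 + p * m1) =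
  (-1) ^+ (m0 + m1) * ('C(n, m0))%:R * ('C(n, m1))%:R.
Proof.
move=> h; rewrite /jacP0 coef_mul_compXn ?size_1subX; [|lia|lia].
by rewrite !coef_1subXn exprD; ring.
Qed.

End Coef.

(** * The two evaluations agree *)

(** Multiplication by [p] modulo [p ^ 2 - 1] swaps the two base [p] digits, so the companion of
    [M = m0 + p m1] in [oct_sum_mod_p2] is [M' = m1 + p m0]. *)
Definition jacZ (p n m0 m1 : nat) : int :=
  (jacP0 p n)`_(m0 + p * m1) + p%:Z * n%:Z *
    ((jacB p n)`_(m0 + p * m1) + (jacB p n)`_(m1 + p * m0)).

Definition jcorr (n m0 m1 : nat) : rat :=
  (n - m1)%N%:R * (harm n - harm (n - m0)) + m1%:R * (harm n - harm m0).

Lemma jacZ_cong (p n m0 m1 : nat) : prime p -> p = (2 * n + 1)%N -> (m0 <= n)%N -> (m1 <= n)%N ->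
  rat_congr_pow p 2 (jacZ p n m0 m1)%:~R
   ((-1) ^+ (m0 + m1) * ('C(n, m0))%:R * ('C(n, m1))%:R * (1 + p%:R * (jcorr n m0 m1 + jcorr n
     m1 m0))).
Proof.
move=> pp ep h0 h1; rewrite /jacZ rmorphD rmorphM rmorphD rmorphM /= -[(p%:Z)%:~R]/(p%:R)
  -[(n%:Z)%:~R]/(n%:R).
have e0 := jacP0_coef pp ep m1 h0.
have -> : ((jacP0 p n)`_(m0 + p * m1))%:~R =
  (-1) ^+ (m0 + m1) * ('C(n, m0))%:R * ('C(n, m1))%:R :> rat.
  by rewrite e0 !rmorphM rmorphXn rmorphN1 !rmorph_nat.
set c := (-1) ^+ _ * _ * _; rewrite [c * _]mulrDr mulr1; apply: congD => //;
  first exact: cong_refl.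
rewrite mulrCA -mulrA; apply: cong_pS => //; rewrite [n%:R * _]mulrDr [c * _]mulrDr;
  apply: congD => //.
  exact: jacB_cong.
have -> : c = (-1) ^+ (m1 + m0) * ('C(n, m1))%:R * ('C(n, m0))%:R.
  by rewrite addnC /c; ring.
exact: jacB_cong.
Qed.

Lemma cong_1p_mod (p : nat) c u v : prime p -> pint p c -> rat_congr_pow p 1 u v ->
  rat_congr_pow p 2 (c * (1 + p%:R * u)) (c * (1 + p%:R * v)).
Proof.
move=> pp hc uv; apply: congMl => //; apply: congD => //; first exact: cong_refl.
exact: cong_pS.
Qed.

Lemma prime_ndvd_fact p m : prime p -> (m < p)%N -> ~~ (p %| m`!)%N.
Proof.
move=> pp; elim: m => [|m IH] mp; first by rewrite fact0 dvdn1 neq_ltn prime_gt1 ?orbT.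
by rewrite factS Euclid_dvdM // negb_or gtnNdvd //= IH // ltnW.
Qed.

(** Since [m0] is [f] or its complement [g], both binomials of [jacZ_cong] are ['C(g + f, f)] and
    the leading terms agree. The corrections are multiplied by [p], so comparing them modulo [p]
    suffices. *)
Lemma jacZ_hmoment (p f g m0 : nat) : prime p -> (f <= g)%N -> p = (2 * (g + f) + 1)%N ->
  hmoment (g + f) (fun=> 1) * hden p f g = hnum p f g (g + f) ->
  m0 = f \/ m0 = g -> odd (m0 + f) = odd (g - f) ->
  rat_congr_pow p 1 (jcorr (g + f) m0 f + jcorr (g + f) f m0) (hcorr f g) ->
  rat_congr_pow p 2 (jacZ p (g + f) m0 f)%:~R (hmoment (g + f) (fun=> 1))
  /\ punit p (hmoment (g + f) (fun=> 1)).
Proof.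
move=> pp fg ep closed hm0 sgn hj.
have hT := hmoment_cong_bin pp fg ep closed.
have uC : punit p ('C(g + f, f))%:R.
  have h := bin_fact (leq_addl g f); apply: punit_nat => //; apply/negP => d.
  have : (p %| (g + f)`!)%N by rewrite -h dvdn_mulr.
  by apply/negP; apply: prime_ndvd_fact => //; lia.
have hc := pint_hcorr pp fg ep.
split; last first.
  apply: (punit_cong pp hT); apply: punitM => //; last exact: punit_1p.
  by apply: punitM => //; apply: punitX => //; apply: punitN => //; exact: punit1.
apply: (@cong_trans _ pp _ ((-1) ^+ (g - f) * ('C(g + f, f))%:R ^+ 2 * (1 + p%:R * hcorr f
  g))); last exact: cong_sym.
have le0 : (m0 <= g + f)%N by case: hm0 => ->; [exact: leq_addl | exact: leq_addr].
apply: (cong_trans pp (jacZ_cong pp ep le0 (leq_addl g f))).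
have -> : 'C(g + f, m0) = 'C(g + f, f).
  by case: hm0 => -> //; rewrite -bin_sub ?leq_addr // addKn.
have -> : (-1) ^+ (m0 + f) = (-1) ^+ (g - f) :> rat by rewrite -signr_odd sgn signr_odd.
rewrite -[_ * _%:R * _%:R]mulrA -expr2; apply: cong_1p_mod => //.
by apply: pintM => //; apply: pintX => //; [exact: (pint_int pp (-1)) | exact: pint_nat].
Qed.

Lemma jacZ_hmoment1 p f : prime p -> p = (8 * f + 1)%N ->
  rat_congr_pow p 2 (jacZ p (4 * f) f f)%:~R (hmoment (4 * f) (fun=> 1))
  /\ punit p (hmoment (4 * f) (fun=> 1)).
Proof.
move=> pp ep; have epn : p = (2 * (3 * f + f) + 1)%N by lia.
have fg : (f <= 3 * f)%N by lia.
have enf : (4 * f = 3 * f + f)%N by lia.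
have closed := hmoment_closed1 ep; rewrite enf in closed *.
apply: (jacZ_hmoment (g := 3 * f)) => //; [by left| |].
  by rewrite (_ : (3 * f - f = f + f)%N) //; lia.
apply/congP.
(* The two [jcorr] carry the coefficients [6 f] and [2 f] on these differences, [hcorr] has [- 3/4]
   and [- 1/4]; the discrepancies are [3/4 p] and [1/4 p]. *)
exists (3 / 4 * (harm (3 * f + f) - harm (3 * f)) + 4^-1 * (harm (3 * f + f) - harm f)).
  have h4 : pint p 4^-1 by apply: punit_pint; apply: punitV; apply: (punit4 pp fg epn).
  have hB m : (m <= 3 * f + f)%N -> pint p (harm (3 * f + f) - harm m).
    by move=> hm; apply: pintB => //; apply: (pint_harm pp fg epn).
  by apply: pintD => //; do ?apply: pintM => //; try exact: pint_nat; apply: hB; lia.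
have epR : p%:R = 8 * f%:R + 1 :> rat by rewrite ep natr_lin.
rewrite /jcorr /hcorr addnK expn1 epR natrM.
by move: (harm _) (harm _) (harm _) (f%:R) => a b c F; field.
Qed.

Lemma jacZ_hmoment3 p f : prime p -> p = (8 * f + 3)%N ->
  rat_congr_pow p 2 (jacZ p (4 * f).+1 (3 * f).+1 f)%:~R (hmoment (4 * f).+1 (fun=> 1))
  /\ punit p (hmoment (4 * f).+1 (fun=> 1)).
Proof.
move=> pp ep; have epn : p = (2 * ((3 * f).+1 + f) + 1)%N by lia.
have fg : (f <= (3 * f).+1)%N by lia.
have enf : ((4 * f).+1 = (3 * f).+1 + f)%N by lia.
have closed := hmoment_closed3 ep; rewrite enf in closed *.
apply: jacZ_hmoment => //; [by right| |].
  have -> : ((3 * f).+1 - f = (f + f).+1)%N by lia.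
  have -> : ((3 * f).+1 + f = (f + f).+1 + (f + f))%N by lia.
  by rewrite oddD /= !addnn !odd_double.
apply/congP.
(* Now the coefficients are [6 f + 2] against [- 1/4] and [2 f] against [- 3/4], again off by
   [3/4 p] and [1/4 p]. *)
exists (3 / 4 * (harm ((3 * f).+1 + f) - harm f) + 4^-1 * (harm ((3 * f).+1 + f) - harm (3 *
  f).+1)).
  have h4 : pint p 4^-1 by apply: punit_pint; apply: punitV; apply: (punit4 pp fg epn).
  have hB m : (m <= (3 * f).+1 + f)%N -> pint p (harm ((3 * f).+1 + f) - harm m).
    by move=> hm; apply: pintB => //; apply: (pint_harm pp fg epn).
  by apply: pintD => //; do ?apply: pintM => //; try exact: pint_nat; apply: hB; lia.
have epR : p%:R = 8 * f%:R + 3 :> rat by rewrite ep natr_lin.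
rewrite /jcorr /hcorr addnK addKn expn1 epR -[(3 * f).+1%:R]natr1 natrM.
by move: (harm _) (harm _) (harm _) (f%:R) => a b c F; field.
Qed.

(** Composing [a + b sqrt(-2)] with [A + B sqrt(-2) = (x + y sqrt(-2)) ^ 2] or its conjugate gives
    norm [p ^ 4]. One of [a B - b A], [a B + b A] is divisible by [p ^ 2], as [p] cannot divide
    both, and then it must vanish since twice its square is at most [p ^ 4]. Assuming that [p] does
    not divide [a] excludes [a = p] or [- p] with [b = 0]. *)
Lemma norm_unique (p : nat) (a b x y : int) : prime p -> odd p ->
  a ^+ 2 + 2 * b ^+ 2 = p%:Z ^+ 2 -> ~~ (p%:Z %| a)%Z -> p%:Z = x ^+ 2 + 2 * y ^+ 2 ->
  a = x ^+ 2 - 2 * y ^+ 2 \/ a = - (x ^+ 2 - 2 * y ^+ 2).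
Proof.
move=> pp op hab hpa hxy.
set A := x ^+ 2 - 2 * y ^+ 2; pose B := 2 * x * y.
have hAB : A ^+ 2 + 2 * B ^+ 2 = p%:Z ^+ 2 by rewrite hxy /A /B; ring.
suff h : a ^+ 2 = A ^+ 2.
  by move/eqP: h; rewrite eqf_sqr => /orP[] /eqP ->; [left | right].
have p0 : p%:Z != 0 by rewrite eqz_nat -lt0n prime_gt0.
have prod : 2 * ((a * B - b * A) * (a * B + b * A)) = p%:Z ^+ 2 * (a ^+ 2 - A ^+ 2).
  transitivity ((A ^+ 2 + 2 * B ^+ 2) * a ^+ 2 - (a ^+ 2 + 2 * b ^+ 2) * A ^+ 2); first by ring.
  by rewrite hAB hab; ring.
have key s : s ^+ 2 = 1 -> (p%:Z ^+ 2 %| a * B + s * (b * A))%Z -> a ^+ 2 = A ^+ 2.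
  move=> s2 /dvdzP[k ek].
  have e4 : (a * A - s * 2 * (b * B)) ^+ 2 + 2 * (a * B + s * (b * A)) ^+ 2 =
    p%:Z ^+ 2 * p%:Z ^+ 2.
    transitivity ((a ^+ 2 + 2 * b ^+ 2) * (A ^+ 2 + 2 * B ^+ 2)); last by rewrite hab hAB.
    transitivity (a ^+ 2 * A ^+ 2 + s ^+ 2 * 4 * (b ^+ 2 * B ^+ 2) + 2 * (a ^+ 2 * B ^+ 2) + 2
      * s ^+ 2 * (b ^+ 2 * A ^+ 2)); first by ring.
    by rewrite s2; ring.
  have k0 : k = 0.
    have P0 : 0 < p%:Z ^+ 2 * p%:Z ^+ 2 by rewrite mulr_gt0 // exprn_even_gt0 //= p0.
    have := sqr_ge0 (a * A - s * 2 * (b * B)).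
    rewrite ek in e4; have e5 : (k * p%:Z ^+ 2) ^+ 2 = k ^+ 2 * (p%:Z ^+ 2 * p%:Z ^+ 2) by ring.
    rewrite e5 in e4; move: (_ ^+ 2) (p%:Z ^+ 2 * p%:Z ^+ 2) e4 P0 => X P e4 P0 X0.
    case: (eqVneq k 0) => // kn0.
    have : 1 <= k ^+ 2 by rewrite -gtz0_ge1 exprn_even_gt0.
    move=> K1; have KP : P <= k ^+ 2 * P by rewrite ler_peMl // ltW.
    by move: (k ^+ 2 * P) e4 KP X0 P0; clear => Q e4 KP X0 P0; lia.
  rewrite k0 mul0r in ek.
  have aB : a * B = - s * (b * A) by apply/eqP; rewrite mulNr -addr_eq0 ek.
  have e6 : a ^+ 2 * B ^+ 2 = b ^+ 2 * A ^+ 2 by rewrite -exprMn aB exprMn sqrrN s2 mul1r exprMn.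
  have e7 : p%:Z ^+ 2 * (a ^+ 2 - A ^+ 2) = 0.
    by rewrite -prod; transitivity (2 * (a ^+ 2 * B ^+ 2 - b ^+ 2 * A ^+ 2));
      [ring | rewrite e6; ring].
  by move/eqP: e7; rewrite mulf_eq0 expf_eq0 (negPf p0) andbF subr_eq0 => /eqP.
have p2 : ~~ (p%:Z %| 2)%Z.
  by rewrite dvdzE /= gtnNdvd // ltn_neqAle prime_gt1 // andbT; apply: contraTneq op => <-.
have dM := dvdz_primeM pp.
have hB : ~~ (p%:Z %| B)%Z.
  have dX z : (p%:Z %| z ^+ 2)%Z = (p%:Z %| z)%Z by rewrite expr2 dM orbb.
  have hyx : (p%:Z %| x)%Z = (p%:Z %| y)%Z.
    rewrite -dX -[RHS]dX.
    have -> : (p%:Z %| y ^+ 2)%Z = (p%:Z %| 2 * y ^+ 2)%Z by rewrite dM (negPf p2).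
    have -> : x ^+ 2 = p%:Z - 2 * y ^+ 2 by rewrite hxy; ring.
    by rewrite (rpredBl _ (dvdzz _)).
  rewrite /B !dM (negPf p2) /= hyx orbb; apply/negP => dy.
  have dx : (p%:Z %| x)%Z by rewrite hyx.
  case/dvdzP: dx hxy => u ->; case/dvdzP: dy => v -> e.
  have : p%:Z * 1 = p%:Z * (p%:Z * (u ^+ 2 + 2 * v ^+ 2)) by rewrite mulr1 {1}e; ring.
  move/(mulfI p0) => e1; have : (p%:Z %| 1%R)%Z by rewrite e1 dvdz_mulr.
  rewrite dvdzE /= dvdn1 => /eqP p1; have := prime_gt1 pp; by rewrite p1.
have cop s : ~~ (p%:Z %| s)%Z -> coprimez (p%:Z ^+ 2) (2 * s).
  by move=> hs; rewrite coprimezXl // coprimezE /= prime_coprime // -[p]/(`|p%:Z|)%N -dvdzE dM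
    negb_or p2.
have dprod : (p%:Z ^+ 2 %| 2 * ((a * B - b * A) * (a * B + b * A)))%Z by rewrite prod dvdz_mulr.
have [du|nu] := boolP (p%:Z %| a * B - b * A)%Z; last first.
  apply: (key 1) => //; rewrite mul1r -(Gauss_dvdzr _ (cop _ nu)).
  by rewrite -mulrA.
have nv : ~~ (p%:Z %| a * B + b * A)%Z.
  apply/negP => dv; have : (p%:Z %| 2 * (a * B))%Z.
    have -> : 2 * (a * B) = (a * B - b * A) + (a * B + b * A) by ring.
    exact: rpredD.
  by rewrite dM (negPf p2) dM (negPf hpa) (negPf hB).
apply: (key (-1)); first by rewrite sqrrN expr1n.
rewrite mulN1r -(Gauss_dvdzr _ (cop _ nv)).
by rewrite -mulrA [(a * B + _) * _]mulrC.
Qed.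

Lemma punit_ndvdz p (c : int) : prime p -> punit p c%:~R -> ~~ (p%:Z %| c)%Z.
Proof.
move=> pp uc; apply/negP => d.
have [] := @punit_cong1 p pp 0 c%:~R _ uc; last by rewrite eqxx.
by apply: (cong_int pp 1 0 c).2; rewrite sub0r rpredN expn1.
Qed.

Lemma hmoment_cong_norm (p n m0 m1 : nat) (x y : int) :
  prime p -> p = (2 * n + 1)%N -> p%:Z = x ^+ 2 + 2 * y ^+ 2 ->
  (8 * (m0 + p * m1) = (p ^ 2).-1)%N -> (p * (m1 + p * m0) = m0 + p * m1 %[mod (p ^ 2).-1])%N ->
  (m1 + p * m0 < (p ^ 2).-1)%N ->
  rat_congr_pow p 2 (jacZ p n m0 m1)%:~R (hmoment n (fun=> 1)) ->
  punit p (hmoment n (fun=> 1)) ->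
  rat_congr_pow p 2 (hmoment n (fun=> 1)) ((-1) ^+ n * (2 * p%:R - 8 * (y ^+ 2)%:~R)).
Proof.
move=> pp ep hxy eM pM' M'lt hZ uT.
have uZ := punit_cong pp hZ uT.
have nZ := punit_ndvdz pp uZ.
have [a [b [hab h4 hdvd]]] := oct_sum_mod_p2 pp ep eM M'lt pM' nZ.
rewrite -/(jacZ p n m0 m1) in hdvd.
have pZ : (p%:Z %| 2 * a + jacZ p n m0 m1)%Z.
  by apply: dvdz_trans hdvd; rewrite dvdzE /= dvdn_exp.
have na : ~~ (p%:Z %| a)%Z.
  apply: contra nZ => da.
  have d2a : (p%:Z %| 2 * a)%Z by apply: dvdz_mull.
  by rewrite -(rpredDl _ d2a).
have op : odd p by rewrite ep oddD oddM.
have hA := norm_unique pp op hab na hxy.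
have e8 : (p%:Z = 4 * (n./2)%:Z + 1 /\ odd n = false) \/ (p%:Z = 4 * (n./2)%:Z + 3 /\ odd n =
  true).
  move: (odd_double_half n) ep; clear; case: (odd n) => /= e ->; [right|left]; split=> //; lia.
have hp2 : (p ^ 2)%N%:Z = p%:Z ^+ 2 by rewrite -mulnn PoszM expr2.
have ea : - (2 * a) = (-1) ^+ n * (2 * p%:Z - 8 * y ^+ 2).
  have eA : x ^+ 2 - 2 * y ^+ 2 = p%:Z - 4 * y ^+ 2 by rewrite hxy; ring.
  rewrite eA in hA; case/dvdzP: h4 => k; rewrite hp2.
  have {e8} [k2 e8] : exists k2 : int, (p%:Z = 4 * k2 + 1 /\ odd n = false) \/ (p%:Z =
    4 * k2 + 3 /\ odd n = true).
    by exists (n./2)%:Z.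
  (* Modulo 4, [a = - p ^ 2 = -1] while [p - 4 y ^ 2 = p]: this forces the minus sign for [p = 1]
     and the plus sign for [p = 3]. *)
  rewrite -signr_odd; case: e8 => -[-> ->] in hA *; rewrite ?expr0 ?expr1 ?mul1r ?mulN1r => e.
    case: hA => ea; last by rewrite ea; ring.
    exfalso; move: e; rewrite ea.
    have -> : (4 * k2 + 1) ^+ 2 = 4 * (4 * k2 ^+ 2 + 2 * k2) + 1 by ring.
    by move: (k2 ^+ 2) (y ^+ 2) => u v; clear; lia.
  case: hA => ea; first by rewrite ea; ring.
  exfalso; move: e; rewrite ea.
  have -> : (4 * k2 + 3) ^+ 2 = 4 * (4 * k2 ^+ 2 + 6 * k2 + 2) + 1 by ring.
  by move: (k2 ^+ 2) (y ^+ 2) => u v; clear; lia.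
apply: (@cong_trans _ pp _ (jacZ p n m0 m1)%:~R); first exact: cong_sym.
have -> : (-1) ^+ n * (2 * p%:R - 8 * (y ^+ 2)%:~R) = (- (2 * a))%:~R :> rat.
  rewrite ea [RHS]rmorphM /= [in RHS]rmorphXn [in RHS]rmorphN1; congr (_ * _).
  by rewrite [RHS]rmorphB; congr (_ - _); rewrite [RHS]rmorphM.
by apply/cong_int => //; rewrite opprK addrC.
Qed.

Theorem theorem2p5 (p : nat) (x y : int) :
  prime p -> (p %% 8 = 1 \/ p %% 8 = 3)%N ->
  (p%:Z = x ^+ 2 + 2 * y ^+ 2) ->
  rat_congr_pow p 2
    (\sum_(0 <= k < (p - 1)./2 + 1)
       ('C(2 * k, k) ^ 3)%:R / ((-64) ^+ k * (k + 1)%:R) : rat)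
    ((-1) ^+ ((p - 1)./2) * (- 12 * (y ^+ 2)%:~R + 2 * p%:R)).
Proof.
move=> pp h8 hxy; set n := ((p - 1)./2)%N.
have ep : p = (2 * n + 1)%N.
  have op : odd p by rewrite (divn_eq p 8) oddD oddM andbF; case: h8 => ->.
  have e := odd_double_half p; rewrite op add1n in e.
  by rewrite /n -e subn1 /= doubleK mul2n addn1.
suff [hT uT] : rat_congr_pow p 2 (hmoment n (fun=> 1)) ((-1) ^+ n * (2 * p%:R - 8 * (y ^+ 2)%:~R))
    /\ punit p (hmoment n (fun=> 1)).
  apply: (cong_trans pp (sum_inv_cong pp ep uT)).
  have -> : (-1) ^+ n * (- 12 * (y ^+ 2)%:~R + 2 * p%:R) =
     3 / 2 * ((-1) ^+ n * (2 * p%:R - 8 * (y ^+ 2)%:~R)) - (-1) ^+ n * p%:R :> rat by field.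
  have u2 : punit p 2 by apply: (@punit2 p 0 n) => //; rewrite addn0.
  apply: congD => //; last exact: cong_refl.
  apply: congMl => //; apply: pintM => //; first exact: pint_nat.
  by apply: punit_pint; apply: punitV.
set f := (p %/ 8)%N; have epf := divn_eq p 8; rewrite -/f in epf.
case: h8 => h8; rewrite h8 in epf.
  have ep1 : p = (8 * f + 1)%N by lia.
  have en : n = (4 * f)%N by lia.
  have [hZ uT] := jacZ_hmoment1 pp ep1; rewrite -en in hZ uT; split=> //.
  have e2 : (8 * (f + p * f) = (p ^ 2).-1)%N by rewrite ep1; lia.
  apply: (hmoment_cong_norm pp ep hxy e2 _ _ hZ uT).
    have -> : (p * (f + p * f) = f * (p ^ 2).-1 + (f + p * f))%N by rewrite ep1; lia.
    by rewrite modnMDl.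
  by rewrite -e2; have := prime_gt1 pp; lia.
have ep3 : p = (8 * f + 3)%N by lia.
have en : n = (4 * f).+1 by lia.
have [hZ uT] := jacZ_hmoment3 pp ep3; rewrite -en in hZ uT; split=> //.
have e2 : (8 * ((3 * f).+1 + p * f) = (p ^ 2).-1)%N by rewrite ep3; lia.
apply: (hmoment_cong_norm pp ep hxy e2 _ _ hZ uT).
  have -> : (p * (f + p * (3 * f).+1) =
    (3 * f).+1 * (p ^ 2).-1 + ((3 * f).+1 + p * f))%N by rewrite ep3; lia.
  by rewrite modnMDl.
by rewrite -e2 ep3; lia.
Qed.
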